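(* Let $\mathsf X$ be a general diffusion on a star-graph $\Gamma$ with scales and speeds $(s_e,m_e)_{e\in E}$, let $\Delta=(V_\Delta,E_\Delta)$ be a subdivision of $\Gamma$, and let $U=\{(e,\zeta):\zeta\in(a,b)\}$, $0<a<b<l_e$, be a cell of $\Delta$ centered within an edge $e\in E$. Let $T_U=\inf\{t\ge0:\mathsf X_t\notin U\}$ and, for $j\in E_\Delta$ and $k\ge0$, let $v^j_k(\mathbf z)=\mathrm E_{\mathbf z}\big(T_U^k\,\mathbf 1_{\{I(T_U)=j\}}\big)$, $\mathbf z\in U$, where $\{I(T_U)=j\}$ is the event that $\mathsf X$ exits $U$ through the edge $j$ of the subdivision. Then, for all $j\in E_\Delta$, all integers $k\ge1$ and all $x\in(a,b)$, $$v^j_k(e,x)=k\int_{(a,b)}G^e_{a,b}(x,y)\,v^j_{k-1}(e,y)\,m_e(\mathrm dy),$$ where $$G^e_{a,b}(x,y)=\frac{(s_e(x\wedge y)-s_e(a))(s_e(b)-s_e(x\vee y))}{s_e(b)-s_e(a)}.$$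
   Context: **Star-graph.** $\Gamma=\big(\bigsqcup_{e\in E}[0,l_e)\big)/\!\sim$ with $E=\{1,\dots,N\}$, $l_e\in(0,\infty]$, where $\sim$ identifies all points $(e,0)$ into the single central vertex $\mathbf v$. It carries the geodesic distance. A subdivision $\Delta=(V_\Delta,E_\Delta)$ of $\Gamma$ is obtained by adding vertices and splitting the edges accordingly; a cell is an open set whose boundary consists of vertices of the subdivision and which contains exactly one vertex of the subdivision, its center. **General diffusion on the star-graph.** A regular continuous strong Markov process $\mathsf X=(I,X)$ on $\Gamma$ without killing ($I$ edge label, $X$ coordinate), $\mathsf X_0=\mathbf x$ under $\mathrm P_{\mathbf x}$ (with expectation $\mathrm E_{\mathbf x}$), determined by positive locally finite measures $m_e$ on $[0,l_e)$ (speeds), continuous increasing functions $s_e$ (scales), $\rho\ge0$, and $\beta_e>0$ with $\sum_e\beta_e=1$: its generator is $\mathrm Lf(e,x)=\frac12\mathrm D_{m_e}\mathrm D_{s_e}f(e,x)$ on the set of $f\in C(\Gamma)$ with $\mathrm Lf\in C(\Gamma)$ and $\sum_{e'\in E}\beta_{e'}f'(e',0)=\rho\,\mathrm Lf(\mathbf v)$.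
   Formalization: The speed measures are normalised so that L = D_m D_s instead of ½ D_m D_s; with the ½ the formula fails by a factor 2 (Brownian motion, s(x)=x, m Lebesgue: E_x T_U=(x−a)(b−x), but the integral of G is half of that). *)

(* Defs.v *)
From HB Require Import structures.
From mathcomp Require Import all_boot all_order all_algebra generic_quotient.
From mathcomp Require Import lra.
From mathcomp Require Import all_classical all_reals all_analysis.

Set Implicit Arguments.
Unset Strict Implicit.
Unset Printing Implicit Defensive.

Import Order.TTheory GRing.Theory Num.Theory.
Import numFieldNormedType.Exports.

Local Open Scope classical_set_scope.
Local Open Scope ring_scope.

(* The edge set is {0, ..., N} with N = (nb_edges).-1, so that there is at
   least one edge and the central vertex exists. *)
Record star_graph (R : realType) := StarGraph {
  edge_pred : nat;
  len : 'I_edge_pred.+1 -> \bar R;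
  len_gt0 : forall e, (0 < len e)%E }.

Definition edge (R : realType) (G : star_graph R) := 'I_(edge_pred G).+1.

Section Star.
Context {R : realType} (G : star_graph R).

Definition on_edge (p : edge G * R) : bool :=
  (0 <= p.2) && (p.2%:E < len p.1)%E.

Definition rays := {p : edge G * R | on_edge p}.

Definition same_point (p q : rays) : bool :=
  (p == q) || ((val p).2 == 0) && ((val q).2 == 0).

Lemma same_point_refl : reflexive same_point.
Proof. by move=> p; rewrite /same_point eqxx. Qed.

Lemma same_point_sym : symmetric same_point.
Proof. by move=> p q; rewrite /same_point eq_sym andbC. Qed.

Lemma same_point_trans : transitive same_point.
Proof.
move=> q p r; rewrite /same_point => /orP[/eqP-> //|/andP[p0 q0]].
by move=> /orP[/eqP<-|/andP[_ ->]]; rewrite p0 ?q0 orbT.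
Qed.

Canonical same_point_equiv := EquivRel same_point same_point_refl same_point_sym same_point_trans.

Definition star := {eq_quot same_point_equiv}%qT.

HB.instance Definition _ := Choice.copy star {eq_quot same_point_equiv}%qT.

Lemma on_edge0 (e : edge G) : on_edge (e, 0).
Proof. by rewrite /on_edge /= lexx len_gt0. Qed.

(* pt e x is the class of (e, x); it is only meaningful for 0 <= x < len e
   (otherwise it is the central vertex). *)
Definition pt (e : edge G) (x : R) : star :=
  (\pi_star (insubd (exist _ (e, 0) (on_edge0 e) : rays) (e, x)))%qT.

Definition central_vertex : star := pt ord0 0.

HB.instance Definition _ := isPointed.Build star central_vertex.

(* The label of the central vertex is an arbitrary one. *)
Definition label (z : star) : edge G := (val (repr z)).1.
Definition coordinate (z : star) : R := (val (repr z)).2.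

Lemma coordinate_ge0 z : 0 <= coordinate z.
Proof. by rewrite /coordinate; case: (repr z) => p /= /andP[]. Qed.

(* geodesic distance *)
Definition gdist (y z : star) : R :=
  if label y == label z then `|coordinate y - coordinate z| else coordinate y + coordinate z.

Lemma gdistxx z : gdist z z = 0.
Proof. by rewrite /gdist eqxx subrr normr0. Qed.

Lemma gdist_sym y z : gdist y z = gdist z y.
Proof. by rewrite /gdist eq_sym distrC [coordinate y + _]addrC. Qed.

Lemma gdist_eq0 y z : gdist y z = 0 -> y = z.
Proof.
rewrite /gdist; have := coordinate_ge0 y; have := coordinate_ge0 z.
rewrite /label /coordinate => z0 y0 yz0; rewrite -[y]reprK -[z]reprK; move: yz0.
case: ifPn => [/eqP E /normr0P|_ /eqP].
  rewrite subr_eq0 => /eqP E'; congr (\pi_star _)%qT; apply: val_inj.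
  by move: E E'; case: (val (repr y)) (val (repr z)) => [? ?] [? ?] /= -> ->.
rewrite paddr_eq0// => /andP[hy hz].
by apply/eqquotP; rewrite /= /same_point hy hz orbT.
Qed.

Lemma gdist_triangle y x z : gdist x z <= gdist x y + gdist y z.
Proof.
rewrite /gdist; have := coordinate_ge0 x; have := coordinate_ge0 y; have := coordinate_ge0 z.
move: (coordinate x) (coordinate y) (coordinate z) => p q r r0 q0 p0.
have A (u v : R) : u - v <= `|u - v| /\ v - u <= `|u - v|.
  by rewrite ler_norm distrC ler_norm.
have B (u v : R) : 0 <= u -> 0 <= v -> `|u - v| <= u + v.
  by move=> u0 v0; rewrite ler_norml; apply/andP; split; lra.
have := A p q; have := A q r; have := B _ _ p0 r0.
case: (eqVneq (label x) (label y)) => [->|xy];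
  case: (eqVneq (label y) (label z)) => [yz|yz]; rewrite ?yz ?eqxx.
- by rewrite ler_distD.
- by move=> *; lra.
- by rewrite -yz (negbTE xy) => *; lra.
- by case: ifP => _ *; lra.
Qed.

HB.instance Definition _ := @isMetric.Build R star gdist
  gdistxx gdist_eq0 gdist_sym gdist_triangle.

Definition borel_star := g_sigma_algebraType (@open star).

Definition seg (e : edge G) (p : R) (q : \bar R) : set star :=
  [set pt e x | x in [set x : R | p < x /\ (x%:E < q)%E]].

(* A subdivision is given by its vertices: the central one, and finitely many
   in each [0, y] with y < len e. *)
Record subdivision := Subdivision {
  vertices : set star;
  vertices_central : vertices central_vertex;
  vertices_locfin : forall (e : edge G) (y : R), (y%:E < len e)%E ->
    finite_set [set x : R | 0 <= x <= y /\ vertices (pt e x)] }.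

(* The edges of the subdivision are the open segments between two consecutive
   vertices, or between the last vertex of an edge of the graph and its end. *)
Definition edges (D : subdivision) : set (set star) :=
  [set j | exists (e : edge G) (p : R) (q : \bar R),
    [/\ 0 <= p /\ (p%:E < q)%E, vertices D (pt e p),
        q = len e \/
          exists r : R, [/\ q = r%:E, (q < len e)%E & vertices D (pt e r)],
        j = seg e p q & j `&` vertices D = set0]].

Definition is_cell (D : subdivision) (U : set star) : Prop :=
  [/\ open U, closure U `\` interior U `<=` vertices D
    & exists c, U `&` vertices D = [set c]].

(* Stickiness is carried by rho: the masses speed e [set 0] play no role. *)
Record diffusion_coefs := DiffusionCoefs {
  speed : edge G -> {measure set (measurableTypeR R) -> \bar R};
  scale : edge G -> R -> R;
  rho : R;
  beta : edge G -> R;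
  speed_gt0 : forall e (x y : R), 0 <= x -> x < y -> (y%:E < len e)%E ->
    (0 < speed e `]x, y[%classic)%E;
  speed_locfin : forall e (y : R), 0 <= y -> (y%:E < len e)%E ->
    (speed e `[0%R, y]%classic < +oo)%E;
  scale_continuous : forall e,
    {within [set x : R | 0 <= x /\ (x%:E < len e)%E], continuous (scale e)};
  scale_increasing : forall e (x y : R), 0 <= x -> x < y -> (y%:E < len e)%E ->
    scale e x < scale e y;
  rho_ge0 : 0 <= rho;
  beta_gt0 : forall e, 0 < beta e;
  beta_sum1 : \sum_e beta e = 1 }.

(* C(Gamma): the bounded continuous functions. *)
Definition bcontinuous (f : star -> R) : Prop :=
  continuous f /\ exists M : R, forall z, `|f z| <= M.

(* L f = g on the open edge e.  D_s f is the right derivative with respect to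
   the scale, and d(D_s f) = g dm.  Speed measures are normalised so that
   L = D_m D_s (s(x) = x and m(dx) = 2 dx for the Brownian motion), that is, m
   is twice the measure which appears in the convention L = 1/2 D_m D_s: this
   is the normalisation in which G(x, y) m(dy), with the kernel green below,
   is the occupation measure before the exit time. *)
Definition edge_operator (C : diffusion_coefs) (e : edge G) (f g : star -> R) :=
  exists Dsf : R -> R,
    (forall x : R, 0 < x -> (x%:E < len e)%E ->
      (f (pt e u) - f (pt e x)) / (scale C e u - scale C e x)
        @[u --> x^'+] --> Dsf x) /\
    (forall x y : R, 0 < x -> x < y -> (y%:E < len e)%E ->
      Dsf y - Dsf x = \int[speed C e]_(z in `]x, y]) g (pt e z)).

Definition vertex_condition (C : diffusion_coefs) (f g : star -> R) :=
  exists f'0 : edge G -> R,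
    (forall e, (f (pt e u) - f (pt e 0)) / u @[u --> 0^'+] --> f'0 e) /\
    \sum_e beta C e * f'0 e = rho C * g central_vertex.

(* The graph {(f, L f)} of the operator L. *)
Definition diffusion_operator (C : diffusion_coefs) (f g : star -> R) : Prop :=
  [/\ bcontinuous f, bcontinuous g, forall e, edge_operator C e f g
    & vertex_condition C f g].

(* sigma-algebra on the paths [0, +oo) -> Gamma generated by the coordinates *)
Definition path_measurable : set (set (R -> star)) :=
  <<s [set B | exists (t : R) (A : set borel_star),
         [/\ 0 <= t, measurable A & B = [set w | A (w t)]]] >>.

Section Process.
Context {d : measure_display} {Om : measurableType d}.
(* P z is the law P_z on Om; only the times t >= 0 are relevant in X t. *)
Variables (P : R.-pker borel_star ~> Om) (X : R -> Om -> star).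

Definition past (t : R) : set (set Om) :=
  <<s [set B | exists (s : R) (A : set borel_star),
         [/\ 0 <= s <= t, measurable A & B = X s @^-1` A]] >>.

Definition stopping_time (tau : Om -> \bar R) : Prop :=
  (forall w, (0 <= tau w)%E) /\
  forall t : R, 0 <= t -> past t [set w | (tau w <= t%:E)%E].

Definition past_stopped (tau : Om -> \bar R) : set (set Om) :=
  [set A | forall t : R, 0 <= t -> past t (A `&` [set w | (tau w <= t%:E)%E])].

(* On {tau < +oo}, conditionally on the past of tau, the path of X after tau
   has the law of X under P_z with z = X_tau. *)
Definition strong_markov : Prop :=
  forall (tau : Om -> \bar R) (A : set Om) (B : set (R -> star)) (x : star),
    stopping_time tau -> past_stopped tau A -> path_measurable B ->
    let A' := A `&` [set w | (tau w < +oo)%E] in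
    P x (A' `&` [set w | B (fun t => X (fine (tau w) + t) w)]) =
    (\int[P x]_(w in A')
       P (X (fine (tau w)) w) [set w' | B (fun t => X t w')])%E.

Definition transition_semigroup (t : R) (f : star -> R) (z : star) : R :=
  \int[P z]_w f (X t w).

(* Graph of the infinitesimal generator on bounded continuous functions, the
   limit being pointwise with uniformly bounded difference quotients. *)
Definition infinitesimal_generator (f g : star -> R) : Prop :=
  [/\ bcontinuous f, bcontinuous g,
      exists M : R, forall (t : R) z, 0 < t ->
        `|(transition_semigroup t f z - f z) / t| <= M
    & forall z, (transition_semigroup t f z - f z) / t @[t --> 0^'+] --> g z].

Record general_diffusion (C : diffusion_coefs) : Prop := {
  process_measurable : forall t : R, 0 <= t ->
    measurable_fun [set: Om] (X t : Om -> borel_star);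
  process_continuous : forall w,
    {within [set t : R | 0 <= t], continuous (fun t => X t w)};
  process_start : forall z, P z [set w | X 0 w = z] = 1%E;
  process_strong_markov : strong_markov;
  process_regular : forall y z,
    (0 < P y [set w | exists t : R, (0 <= t)%R /\ X t w = z])%E;
  process_generator : forall f g,
    infinitesimal_generator f g <-> diffusion_operator C f g }.

Definition exit_time (U : set star) (w : Om) : \bar R :=
  ereal_inf [set t%:E | t in [set t : R | 0 <= t /\ ~ U (X t w)]].

(* X leaves U (in finite time) through the edge j of a subdivision: j is one of
   the edges inside the cell U, and X is at an end of j when it leaves U. *)
Definition exits_through (U j : set star) : set Om :=
  [set w | j `<=` U /\
     exists t : R, exit_time U w = t%:E /\ closure j (X t w)].

Definition exit_moment (U j : set star) (k : nat) (z : star) : \bar R :=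
  (\int[P z]_w (exit_time U w ^+ k * (\1_(exits_through U j) w)%:E))%E.

End Process.

Definition green (C : diffusion_coefs) (e : edge G) (a b x y : R) : R :=
  let s := scale C e in
  (s (Num.min x y) - s a) * (s b - s (Num.max x y)) / (s b - s a).

End Star.

(* Main.v *)
(* Write T for the exit time of U and v_k for the k-th moment. Only the Markov
   property at deterministic times is needed. Since
     T^k = k int_0^T (T - t)^(k-1) dt,
   conditioning on the past of t gives
     v_k(x) = k E_x int_0^T v_(k-1)(X_t) dt,
   so it remains to see that G(x, y) m(dy) is the occupation measure of X
   before T.  If L f = g, then shifting time by r,
     E_x int_0^T (P_r f - f)(X_t) dt = E_x (int_T^(T+r) f(X_t) dt - int_0^r f(X_t) dt),
   and dividing by r -> 0 yields Dynkin's formula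
     E_x int_0^T g(X_t) dt = E_x f(X_T) - f(x)
   (with T replaced by T /\ N, until T is known to be integrable).  Given a
   continuous h supported in [a, b], one corrects it outside of U by two bumps,
   one on each side, so that the solution f of D_m D_s f = g is constant near
   both ends of the edge (hence is in the domain of L) and f(a) = f(b);  then
   f(a) - f(x) = int G(x, y) h(y) m(dy).  Intervals are limits of such h, and a
   monotone class argument concludes. *)
Require Import Defs.
From HB Require Import structures.
From mathcomp Require Import all_boot all_order all_algebra generic_quotient.
From mathcomp Require Import ring lra finmap.
From mathcomp Require Import all_classical all_reals all_analysis.
From mathcomp Require Import measurable_realfun.

Set Implicit Arguments.
Unset Strict Implicit.
Unset Printing Implicit Defensive.

Import Order.TTheory GRing.Theory Num.Theory.
Import numFieldNormedType.Exports.

Local Open Scope classical_set_scope.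
Local Open Scope ring_scope.

(** * Integration and calculus preliminaries *)

(** The obstacle is the measurability of $T$: an event of the sigma-algebra of coordinates depends
    on countably many times, so $T$ can only be measured on continuous paths. Path functionals
    therefore live on [path_space], with the trace sigma-algebra; all trajectories being continuous,
    the Markov property carries over. The two bumps, supported in $[p, a]$ and $[b, q]$, solve two
    linear conditions. Total mass zero of $g\,dm$ makes the slope vanish beyond $q$; as $f$ is also
    constant near the central vertex and on the other edges, the vertex condition reads $0 = 0$ for
    any $\rho$ and $\beta_e$. The condition $f(a) = f(b)$ makes $E f(X_T)$ known without the exit
    probabilities. Integrability of $T$ comes from the same formula. At $T \wedge N$ and for $0 \le
    h \le 1$ it gives $E \int_0^{T \wedge N} h(X_t) dt \le \int G h\,dm$; tents $h$ increasing to
    $1$ on $(a, b)$ bound $E(T \wedge N)$ by $\int G\,dm$, hence $P(T > N) \le \int G\,dm / N$, and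
    the truncation error, at most $f(a) P(T > N)$, vanishes. *)

Lemma bounded_integrable d (T : measurableType d) (R : realType)
    (mu : {measure set T -> \bar R}) (A : set T) (g : T -> R) (K : R) :
  measurable A -> (mu A < +oo)%E ->
  measurable_fun A g -> (forall t, A t -> `|g t| <= K) -> mu.-integrable A (EFin \o g).
Proof.
move=> mA Afin mg gK; apply: measurable_bounded_integrable => //.
by exists K; split => [|K' KK' t At]; [rewrite num_real|exact: le_trans (gK t At) (ltW KK')].
Qed.

Lemma cvgn_EFin (R : realType) (u : nat -> R) (l : R) :
  u n @[n --> \oo] --> l -> (u n)%:E @[n --> \oo] --> l%:E.
Proof. by move=> ul; apply/fine_cvgP; split; [exact: nearW|exact: ul]. Qed.

Lemma nondecreasing_cvg_integral d (T : measurableType d) (R : realType)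
    (mu : {measure set T -> \bar R}) (D : set T) (F : nat -> T -> \bar R)
    (f : T -> \bar R) :
  measurable D -> (forall n, measurable_fun D (F n)) ->
  (forall n t, D t -> (0 <= F n t)%E) ->
  (forall t, D t -> {homo F ^~ t : m n / (m <= n)%N >-> (m <= n)%E}) ->
  (forall t, D t -> F n t @[n --> \oo] --> f t) ->
  (\int[mu]_(t in D) F n t)%E @[n --> \oo] --> (\int[mu]_(t in D) f t)%E.
Proof.
move=> mD mF F0 ndF Ff.
rewrite (eq_integral (fun t => limn (F ^~ t))); last first.
  by move=> t; rewrite inE => Dt; apply/esym/cvg_lim => //; exact: Ff.
exact: cvg_monotone_convergence.
Qed.

Section measurable_induction.
Import HBNNSimple.
Context {d : measure_display} {T : measurableType d} {R : realType}.
Implicit Types f g : T -> \bar R.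

(** Functional form of the monotone class argument: [nnsfun_approx] increases to [f], and each
    simple function is a finite sum of nonnegative multiples of indicators. It serves for the Markov
    property and for the occupation formula. *)
Lemma ge0_measurable_ind (K : (T -> \bar R) -> Prop) :
  (forall A, measurable A -> K (fun t => (\1_A t)%:E)) ->
  (forall (c : R) f, 0 <= c -> measurable_fun setT f ->
    (forall t, (0 <= f t)%E) -> K f -> K (fun t => (c%:E * f t)%E)) ->
  (forall f g, measurable_fun setT f -> measurable_fun setT g ->
    (forall t, (0 <= f t)%E) -> (forall t, (0 <= g t)%E) ->
    K f -> K g -> K (fun t => (f t + g t)%E)) ->
  (forall (F : nat -> T -> \bar R) f,
    (forall n, measurable_fun setT (F n)) -> measurable_fun setT f ->
    (forall n t, (0 <= F n t)%E) ->
    (forall t, {homo F ^~ t : m n / (m <= n)%N >-> (m <= n)%E}) ->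
    (forall t, F n t @[n --> \oo] --> f t) ->
    (forall n, K (F n)) -> K f) ->
  forall f, measurable_fun setT f -> (forall t, (0 <= f t)%E) -> K f.
Proof.
move=> Kind Kscale Kadd Klim f mf f0.
pose F := nnsfun_approx measurableT mf.
have KF n : K (EFin \o F n).
  have -> : EFin \o F n = fun t =>
      (\sum_(y <- fset_set (range (F n))) (y * \1_(F n @^-1` [set y]) t)%:E)%E.
    apply/funext => t /=; rewrite (fimfunE (F n)) fsbig_finite//=.
    by rewrite sumEFin.
  (* The closure under scaling is about nonnegative constants, and the values of [F n] are such. *)
  have : forall y, y \in (fset_set (range (F n)) : seq R) -> 0 <= y.
    by move=> y; rewrite in_fset_set// inE => -[t _ <-].
  elim: (enum_fset (fset_set _)) => [_|y s IH ys].
    have -> : (fun t => \sum_(y <- [::]) (y * \1_(F n @^-1` [set y]) t)%:E)%E =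
        fun t => ((\1_(set0 : set T) t)%:E : \bar R).
      by apply/funext => t; rewrite big_nil indic0.
    exact: Kind.
  under eq_fun do rewrite big_cons.
  have y0 : 0 <= y by apply: ys; rewrite in_cons eqxx.
  have my : measurable (F n @^-1` [set y]).
    by apply: measurable_funPTI.
  apply: Kadd.
  - apply/measurable_EFinP; apply: measurable_funM => //.
  - apply: emeasurable_sum => z; apply/measurable_EFinP.
    by apply: measurable_funM => //; apply: measurable_indic; exact: measurable_funPTI.
  - by move=> t; rewrite lee_fin mulr_ge0.
  - move=> t; rewrite big_seq; apply: sume_ge0 => z zs.
    by rewrite lee_fin mulr_ge0// ys// in_cons zs orbT.
  - under eq_fun do rewrite EFinM.
    by apply: Kscale => //; [exact/measurable_EFinP/measurable_indic|exact: Kind].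
  - by apply: IH => z zs; apply: ys; rewrite in_cons zs orbT.
apply: (Klim (fun n => EFin \o F n)) => //.
- by move=> n; apply/measurable_EFinP.
- by move=> n t; rewrite /= lee_fin.
- by move=> t m n mn; rewrite /= lee_fin; exact/lefP/nd_nnsfun_approx.
- by move=> t; exact: cvg_nnsfun_approx.
Qed.

End measurable_induction.

Section caratheodory_function.
Context {d : measure_display} {T : measurableType d} {R : realType}.

(* The left Riemann discretisations [f (floor (n s) / n) w] are measurable and
   converge pointwise. *)
Lemma measurable_caratheodory (f : R -> T -> R) :
  (forall s, measurable_fun setT (f s)) -> (forall w, continuous (f ^~ w)) ->
  measurable_fun setT (fun p : measurableTypeR R * T => f p.1 p.2).
Proof.
move=> mf cf.
pose q (n : nat) (s : R) : R := (Num.floor (n.+1%:R * s))%:~R / n.+1%:R.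
apply: (@measurable_fun_cvg _ _ _ setT (fun n p => f (q n p.1) p.2)).
- move=> n _ B mB; rewrite setTI.
  have -> : (fun p : measurableTypeR R * T => f (q n p.1) p.2) @^-1` B =
    \bigcup_(k in [set: int]) ([set s : R | Num.floor (n.+1%:R * s) = k] `*`
      (f (k%:~R / n.+1%:R) @^-1` B)).
    apply/seteqP; split => [[s w]/= fB|[s w]/= [k _ [/= <-]]//].
    by exists (Num.floor (n.+1%:R * s)).
  apply: countable_bigcupT_measurable; first exact: countableP.
  move=> k; apply: measurableX.
    rewrite [X in measurable X](_ : _ =
       `[k%:~R / n.+1%:R, (k + 1)%:~R / n.+1%:R[%classic) //.
    apply/seteqP; split => s /=; rewrite in_itv/= ler_pdivrMr// ltr_pdivlMr//.
      by move=> <-; rewrite ![s * _]mulrC floor_le_tmp floorD1_gt.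
    by rewrite ![s * _]mulrC => /floor_def.
  by rewrite -[X in measurable X]setTI; exact: mf.
- move=> [s w] _ /=; apply: (@cvg_comp _ _ _ (fun n => q n s) (f ^~ w) _ (nbhs s)); last exact: cf.
  apply/cvgrPdist_le => e e0; near=> n.
  have n0 : (0 : R) < n.+1%:R by [].
  have -> : s - q n s = (n.+1%:R * s - (Num.floor (n.+1%:R * s))%:~R) / n.+1%:R.
    by rewrite /q mulrBl mulrAC mulfV ?mul1r// gt_eqF.
  have /andP[h1 h2] : 0 <= n.+1%:R * s - (Num.floor (n.+1%:R * s))%:~R <= 1.
    by rewrite subr_ge0 floor_le_tmp lerBlDl -(intrD1) ltW// floorD1_gt.
  rewrite normrM ger0_norm// gtr0_norm ?invr_gt0//.
  apply: (@le_trans _ _ (1 / n.+1%:R)).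
    by rewrite ler_wpM2r// invr_ge0.
  rewrite mul1r; near: n.
  by apply: filterS (near_infty_natSinv_lt (PosNum e0)) => n /ltW.
Unshelve. all: by end_near. Qed.

End caratheodory_function.

Section path_calculus.
Context {R : realType}.
Notation mu := (@lebesgue_measure R).

Lemma continuous_primitive (phi : R -> R) (l u : R) : continuous phi -> l < u ->
  exists G : R -> R, forall x, l < x < u -> is_derive x 1 G (phi x).
Proof.
move=> cphi lu; exists (fun x => \int[mu]_(t in `[l, x]) phi t).
move=> x /andP[lx xu].
have phii : mu.-integrable `[l, u] (EFin \o phi).
  apply: continuous_compact_integrable; first exact: segment_compact.
  exact: continuous_subspaceT.
have [dG <-] := continuous_FTC1_closed xu phii lx (cphi x).
by rewrite derive1E; exact: DeriveDef.
Qed.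

(** The interval is half-open because the lifetime region $0 \le t < T$ is, and it may be empty
    because $T$ may vanish. *)
Lemma continuous_FTC2_co (f F : R -> R) (a b : R) : a <= b -> continuous f ->
  (forall x, a <= x <= b -> is_derive x 1 F (f x)) ->
  (\int[mu]_(x in `[a, b[) (f x)%:E = (F b - F a)%:E)%E.
Proof.
move=> ab cf dF; have [{}ab|] := ltP a b; last first.
  move=> ba; have -> : b = a by apply/eqP; rewrite eq_le ba ab.
  by rewrite set_itvco0 integral_set0 subrr.
rewrite integral_itv_bndo_bndc; last first.
  apply/measurable_EFinP; apply: measurable_funTS.
  exact: continuous_measurable_fun.
rewrite (continuous_FTC2 (F := F) ab); first by rewrite EFinB.
- exact: continuous_subspaceT.
- have cF x : a <= x <= b -> {for x, continuous F}.
    by move=> /dF dFx; apply/differentiable_continuous/derivable1_diffP.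
  split.
  + by move=> x; rewrite in_itv/= => /andP[ax xb]; have [] : is_derive x 1 F (f x) by apply: dF; rewrite !ltW.
  + by apply: cvg_at_right_filter; apply: cF; rewrite lexx ltW.
  + by apply: cvg_at_left_filter; apply: cF; rewrite lexx ltW.
- move=> x; rewrite in_itv/= => /andP[ax xb]; rewrite derive1E; have dFx : is_derive x 1 F (f x) by apply: dF; rewrite !ltW.
  exact: derive_val.
Qed.

(** If [G] is a primitive of [phi], then [D h] is the difference quotient of [G] at [s] minus the
    one at [0]. The mean value theorem bounds each by [M], which is the domination needed in
    Dynkin's formula, and they tend to [phi s] and [phi 0]. *)
Lemma average_increment (phi : R -> R) (M s : R) : continuous phi ->
  (forall t, `|phi t| <= M) -> 0 <= s ->
  let D h := h^-1 * \int[mu]_(t in `[0, s[) (phi (t + h) - phi t) in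
  (forall h, 0 < h -> h <= 1 -> `|D h| <= 2 * M) /\
  D n.+1%:R^-1 @[n --> \oo] --> phi s - phi 0.
Proof.
move=> cphi bphi s0 D.
(* The margins leave room for [s + h] with [h <= 1] and for two-sided derivatives at [0] and
   [s + h]. *)
have [G dG] : exists G : R -> R, forall x, -1 < x < s + 2 ->
    is_derive x 1 G (phi x).
  by apply: continuous_primitive => //; lra.
have DE h : 0 < h -> h <= 1 -> D h = h^-1 * (G (s + h) - G s) - h^-1 * (G h - G 0).
  move=> h0 h1; rewrite /D -mulrBr; congr (_ * _).
  have cdphi : continuous (fun t => phi (t + h) - phi t).
    move=> x; apply: cvgB; last exact: cphi.
    apply: (@cvg_comp _ _ _ (fun t => t + h) phi _ (nbhs (x + h))); last exact: cphi.
    by apply: cvgD => //; exact: cvg_cst.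
  have dGh x : 0 <= x <= s ->
      is_derive x 1 (fun t => G (t + h) - G t) (phi (x + h) - phi x).
    move=> /andP[x0 xs].
    have d1 : is_derive (x + h) 1 G (phi (x + h)) by apply: dG; lra.
    have d2 : is_derive x 1 G (phi x) by apply: dG; lra.
    have d0 : is_derive x 1 (fun t : R => t + h) 1.
      by rewrite -[X in is_derive _ _ _ X]addr0; apply: is_deriveD.
    have d3 : is_derive x 1 (fun t => G (t + h)) (phi (x + h)).
      rewrite -[X in is_derive _ _ _ X]mulr1.
      exact: (@is_derive1_comp _ G (fun t => t + h) x).
    exact: (is_deriveB d3 d2).
  by rewrite /Rintegral (continuous_FTC2_co s0 cdphi dGh)/= add0r; ring.
have GM x h : 0 <= x -> x <= s -> 0 < h -> h <= 1 -> `|h^-1 * (G (x + h) - G x)| <= M.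
  move=> x0 xs h0 h1.
  have [|||c _ ->] := @MVT _ G phi x (x + h).
  - by rewrite ltrDl.
  - by move=> y; rewrite in_itv/= => /andP[? ?]; apply: dG; lra.
  - apply: derivable_within_continuous => y; rewrite in_itv/= => /andP[? ?].
    by have [] : is_derive y 1 G (phi y) by apply: dG; lra.
  - by rewrite addrAC subrr add0r mulrCA mulVf ?mulr1// gt_eqF.
split=> [h h0 h1|].
  rewrite DE// (le_trans (ler_normB _ _))//.
  have := GM 0 h (lexx _) s0 h0 h1; have := GM s h s0 (lexx _) h0 h1.
  by rewrite add0r; lra.
have cvG x : 0 <= x -> x <= s ->
    n.+1%:R^-1^-1 * (G (x + n.+1%:R^-1) - G x) @[n --> \oo] --> phi x.
  move=> x0 xs; have [dGx <-] : is_derive x 1 G (phi x) by apply: dG; lra.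
  move: dGx => /(@cvgr_dnbhsP R (fun h => h^-1 *: (G (h *: 1 + x) - G x)) 0 ('D_1 G x)).
  have -> : (fun n : nat => n.+1%:R^-1^-1 * (G (x + n.+1%:R^-1) - G x)) =
      (fun n => n.+1%:R^-1^-1 *: (G (n.+1%:R^-1 *: 1 + x) - G x)).
    by apply/funext => n; rewrite /GRing.scale/= mulr1 [x + _]addrC.
  by apply; split => [n|]; [rewrite invr_neq0|exact: cvg_harmonic].
apply: (@cvg_trans _ ((n.+1%:R^-1^-1 * (G (s + n.+1%:R^-1) - G s) -
    n.+1%:R^-1^-1 * (G (0 + n.+1%:R^-1) - G 0)) @[n --> \oo])).
  apply: near_eq_cvg; near=> n; rewrite DE ?add0r//.
  by rewrite invf_le1// ler1n.
by apply: cvgB; apply: cvG.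
Unshelve. all: by end_near. Qed.

Lemma integral_pow_co (t : R) (k : nat) : 0 <= t ->
  (\int[mu]_(s in `[0%R, t[) (k.+1%:R * (t - s) ^+ k)%:E = (t ^+ k.+1)%:E)%E.
Proof.
move=> t0.
have cp : continuous (fun s : R => k.+1%:R * (t - s) ^+ k).
  move=> x; apply: cvgM; first exact: cvg_cst.
  apply: (@continuous_comp _ _ _ (fun s => t - s) (fun y => y ^+ k)).
    by apply: cvgB; [exact: cvg_cst|exact: cvg_id].
  exact: exprn_continuous.
have dp x : 0 <= x <= t ->
    is_derive x 1 (fun s : R => - (t - s) ^+ k.+1) (k.+1%:R * (t - x) ^+ k).
  move=> _.
  have d0 : is_derive x 1 (fun s : R => t - s) (-1).
    by rewrite -[X in is_derive _ _ _ X]add0r; apply: is_deriveB.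
  rewrite (_ : (fun s : R => _) = - ((fun s : R => t - s) ^+ k.+1)); last first.
    by apply/funext => s; rewrite !fctE.
  apply: is_derive_eq.
  by rewrite /= scalerN opprK /GRing.scale/= mulr1.
by rewrite (continuous_FTC2_co t0 cp dp) subrr expr0n/= oppr0 sub0r opprK addr0.
Qed.

End path_calculus.

(** * The coordinate along an edge *)

Section edge_coordinate.
Context {R : realType} {G : star_graph R}.
Implicit Types (e : edge G) (x y : R) (z : star G).

(** The retraction of the graph onto the edge [e], all other edges being sent to the central vertex.
    It does not depend on the arbitrary label of that vertex, it is 1-Lipschitz, and for [0 <= a]
    the segment [seg e a b] is the preimage of []a, b[]. *)
Definition edge_coord e z : R := if label z == e then coordinate z else 0.

Lemma label_coordinate_pt e x : 0 <= x -> (x%:E < len e)%E ->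
  coordinate (pt e x) = x /\ (0 < x -> label (pt e x) = e).
Proof.
move=> x0 xl; rewrite /label /coordinate /pt.
set q := insubd _ _.
have vq : val q = (e, x) by rewrite val_insubd /on_edge /= x0 xl.
have : same_point (repr (\pi_(star G) q)%qT) q.
  by apply/eqquotP; exact: (@reprK _ (star G)).
rewrite /same_point vq => /orP[/eqP->|/andP[/eqP-> /=/eqP->]]; first by rewrite vq.
by split => //; rewrite ltxx.
Qed.

(** Out of range, [pt e x] is the central vertex: its coordinate is [0] but its label may be any
    edge, whence the disjunction. *)
Lemma label_pt e x : coordinate (pt e x) = 0 \/ label (pt e x) = e.
Proof.
rewrite /label /coordinate /pt; set q := insubd _ _.
have q1 : (val q).1 = e by rewrite val_insubd; case: ifP.
have : same_point (repr (\pi_(star G) q)%qT) q.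
  by apply/eqquotP; exact: (@reprK _ (star G)).
by rewrite /same_point => /orP[/eqP->|/andP[/eqP-> _]]; [right|left].
Qed.

Lemma edge_coord_pt e x : 0 <= x -> (x%:E < len e)%E ->
  edge_coord e (pt e x) = x.
Proof.
move=> x0 xl; have [cx lx] := label_coordinate_pt x0 xl.
move: x0; rewrite /edge_coord cx le_eqVlt => /predU1P[<-|/lx ->]; first by case: ifP.
by rewrite eqxx.
Qed.

Lemma edge_coord_pt_neq e e' x : e' != e -> edge_coord e (pt e' x) = 0.
Proof.
move=> ee'; rewrite /edge_coord; have [->|->] := label_pt e' x; first by case: ifP.
by rewrite (negbTE ee').
Qed.

Lemma coordinate_lt_len z : ((coordinate z)%:E < len (label z))%E.
Proof. by rewrite /coordinate /label; case: (repr z) => p /= /andP[]. Qed.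

Lemma pt_label_coordinate z : pt (label z) (coordinate z) = z.
Proof.
rewrite /pt /label /coordinate -[RHS]reprK; congr (\pi_(star G) _)%qT.
apply: val_inj; case: (repr z) => -[i u] /= ue; rewrite val_insubd /=.
by move: ue; rewrite /on_edge/= => ->.
Qed.

Lemma pt_edge_coord e z : 0 < edge_coord e z ->
  pt e (edge_coord e z) = z /\ ((edge_coord e z)%:E < len e)%E.
Proof.
rewrite /edge_coord; case: eqVneq => [<- _|]; last by rewrite ltxx.
by split; [exact: pt_label_coordinate|exact: coordinate_lt_len].
Qed.

Lemma edge_coord_lipschitz e (y z : star G) :
  `|edge_coord e y - edge_coord e z| <= gdist y z.
Proof.
rewrite /edge_coord /gdist; have := coordinate_ge0 y; have := coordinate_ge0 z.
move: (coordinate y) (coordinate z) => u v v0 u0.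
case: (eqVneq (label y) (label z)) => [->|yz]; first by case: ifP => // _; rewrite subrr normr0.
case: (eqVneq (label y) e) => [ye|_]; case: (eqVneq (label z) e) => [ze|_].
- by move: yz; rewrite ye ze eqxx.
- by rewrite subr0 ger0_norm// lerDl.
- by rewrite sub0r normrN ger0_norm// lerDr.
- by rewrite subrr normr0 addr_ge0.
Qed.

Lemma continuous_edge_coord e : continuous (edge_coord e).
Proof.
move=> z A /nbhs_ballP[r /= r0 rA].
apply/nbhs_ballP; exists r => //= y zy; apply: rA.
exact: le_lt_trans (edge_coord_lipschitz e z y) zy.
Qed.

Lemma gdist_pt e x y : 0 < x -> (x%:E < len e)%E -> 0 < y -> (y%:E < len e)%E ->
  gdist (pt e x) (pt e y) = `|x - y|.
Proof.
move=> x0 xl y0 yl.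
have [cx lx] := label_coordinate_pt (ltW x0) xl.
have [cy ly] := label_coordinate_pt (ltW y0) yl.
by rewrite /gdist cx cy lx// ly// eqxx.
Qed.

Lemma segE e (a b : R) : 0 <= a -> (b%:E < len e)%E ->
  seg e a b%:E = edge_coord e @^-1` `]a, b[.
Proof.
move=> a0 bl; apply/seteqP; split => [_ [x [ax xb] <-]|z] /=; rewrite in_itv/=.
  rewrite lte_fin in xb; rewrite edge_coord_pt ?ax ?xb//; first by rewrite ltW// (le_lt_trans a0).
  by rewrite (lt_trans _ bl)// lte_fin.
move=> /andP[az zb]; have [zE zl] := pt_edge_coord (le_lt_trans a0 az).
by exists (edge_coord e z) => //; rewrite lte_fin.
Qed.

Lemma borel_continuous (f : star G -> R) : continuous f ->
  measurable_fun setT (f : borel_star G -> R).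
Proof.
move=> cf; apply: (measurability _ (RGenOpens.measurableE R)).
move=> _ [_ [x [y ->]] <-]; rewrite setTI.
apply: sub_sigma_algebra; move/continuousP: cf; apply; exact: interval_open.
Qed.

Lemma borel_pt e (a b : R) : 0 <= a -> (b%:E < len e)%E ->
  measurable_fun `]a, b[%classic (pt e : R -> borel_star G).
Proof.
move=> a0 bl; apply: (@measurability _ _ R (borel_star G) _ _ (@open (star G)) erefl) => _ [A oA <-].
apply: open_measurable; rewrite openE => x [/=]; rewrite in_itv/= => /andP[ax xb] Ax.
have : nbhs (pt e x) A by apply: open_nbhs_nbhs.
move=> /nbhs_ballP[r /= r0 rA].
have x0 : 0 < x by exact: le_lt_trans ax.
have xl : (x%:E < len e)%E by rewrite (lt_trans _ bl)// lte_fin.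
have nb : \forall y \near x, `|x - y| < r by exact: nbhsx_ballx.
have nab : \forall y \near x, y \in `]a, b[ by apply: near_in_itvoo; rewrite in_itv/= ax.
apply: filterS2 nb nab => y xyr; rewrite in_itv/= => /andP[ay yb].
split; first by rewrite /= in_itv/= ay.
apply: rA; rewrite /ball /= gdist_pt//; first exact: le_lt_trans ay.
by rewrite (lt_trans _ bl)// lte_fin.
Qed.

End edge_coordinate.

(** * Exit times on the path space *)

Lemma countable_bigcapT_measurable d (T : measurableType d) (I : countType)
    (F : I -> set T) : (forall i, measurable (F i)) -> measurable (\bigcap_i F i).
Proof.
move=> mF; rewrite -[X in measurable X]setCK setC_bigcap; apply: measurableC.
apply: countable_bigcupT_measurable; first exact: countableP.
by move=> i; exact: measurableC.
Qed.

Section paths.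
Context {R : realType} {G : star_graph R}.
Implicit Types (w : R -> star G) (t r : R).

(* The path is frozen at negative times, so that it is continuous on R. *)
Definition cont_path w := continuous (fun t : R => w (Num.max 0 t)).

Definition shift t w : R -> star G := fun r => w (t + r).

Lemma continuous_max0 : continuous (fun t : R => Num.max 0 t).
Proof.
by move=> u; exact: (@continuous_max R R (cst 0) id u (cvg_cst _) cvg_id).
Qed.

Lemma cont_pathP w : {within [set t : R | 0 <= t], continuous w} -> cont_path w.
Proof.
move=> /subspace_continuousP cw t A.
have m0 : 0 <= Num.max 0 t by rewrite le_max lexx.
move=> /(cw _ m0) wA; apply: (@filterS _ (nbhs t) _ _ _ _ (continuous_max0 wA)) => u /=; apply.
by rewrite le_max lexx.
Qed.

Lemma cont_path_shift t w : 0 <= t -> cont_path w -> cont_path (shift t w).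
Proof.
move=> t0 cw u; rewrite /shift.
have E : (fun r : R => w (t + Num.max 0 r)) =
    (fun r => w (Num.max 0 r)) \o (fun r => t + Num.max 0 r).
  by apply/funext => r /=; rewrite (max_r (addr_ge0 t0 _))// le_max lexx.
rewrite E; apply: continuous_comp; last exact: cw.
by apply: cvgD; [exact: cvg_cst|exact: continuous_max0].
Qed.

(* The trace on continuous paths of the sigma-algebra of the coordinates. *)
Definition path_event : set (set (R -> star G)) :=
  [set B | exists2 B', path_measurable B' &
    forall w, cont_path w -> B w <-> B' w].

(** The exit time becomes measurable for this sigma-algebra because on continuous paths it is
    determined by rational times. *)
Definition path_space := g_sigma_algebraType path_event.

Lemma path_event_sigma_algebra : sigma_algebra setT path_event.
Proof.
have [h0 hC hU] := @smallest_sigma_algebra _ [set: R -> star G]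
  [set B | exists (t : R) (A : set (borel_star G)),
         [/\ 0 <= t, measurable A & B = [set w | A (w t)]]].
split.
- by exists set0.
- move=> A [B mB AB]; exists (setT `\` B); first exact: hC.
  by move=> w cw; split => -[_ h]; split => // /(AB _ cw).
- move=> A /(_ _)/cid2-/(_ _) mA.
  have [B BP] : {B : nat -> set (R -> star G) | forall n, path_measurable (B n) /\
      forall w, cont_path w -> A n w <-> B n w}.
    by exists (fun n => sval (mA n)) => n; case: (mA n).
  exists (\bigcup_n B n); first by apply: hU => n; have [] := BP n.
  by move=> w cw; split => -[n _ h]; exists n => //; apply/(proj2 (BP n) w cw).
Qed.

Lemma measurable_path_event (B : set path_space) : measurable B <-> path_event B.
Proof.
by rewrite /measurable/= (sigma_algebra_id path_event_sigma_algebra).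
Qed.

Lemma measurable_path_coordinate t : 0 <= t ->
  measurable_fun setT ((fun w => w t) : path_space -> borel_star G).
Proof.
move=> t0 _ A mA; rewrite setTI; apply/measurable_path_event.
exists [set w : R -> star G | A (w t)] => //.
by apply: sub_sigma_algebra; exists t, A.
Qed.

(** The trace sigma-algebra does not see discontinuous paths: a function may take any value there,
    or be replaced by one that agrees with it on continuous paths. *)
Lemma eq_cont_path_measurable_fun d (U : measurableType d) (f g : path_space -> U) :
  (forall w, cont_path w -> f w = g w) -> measurable_fun setT g ->
  measurable_fun setT f.
Proof.
move=> fg mg _ A mA; rewrite setTI; apply/measurable_path_event.
have /measurable_path_event[B mB gB] : measurable (g @^-1` A).
  by rewrite -[X in measurable X]setTI; exact: mg.
by exists B => // w cw; rewrite -gB// /preimage/= fg.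
Qed.

Section exit.
Variable U : set (star G).
Hypothesis oU : open U.

(** The exit time of the coordinate process, so that [path_exit U] at [X^~ w] unfolds to
    [exit_time X U w]. *)
Definition path_exit : path_space -> \bar R :=
  exit_time (fun t (w : path_space) => w t) U.

Lemma path_exit_ge0 w : (0 <= path_exit w)%E.
Proof. by apply: le_ereal_inf_tmp => _ [t [t0 _] <-]; rewrite lee_fin. Qed.

Lemma path_exit_le w t : 0 <= t -> ~ U (w t) -> (path_exit w <= t%:E)%E.
Proof. by move=> t0 Ut; apply: ereal_inf_lbound; exists t. Qed.

(** The infimum is attained because [U] is open: a continuous path that is still in [U] at the time
    [t] stays there a little longer, so [t] would not be the infimum. *)
Lemma path_exitP w t : cont_path w ->
  path_exit w = t%:E <-> [/\ 0 <= t, ~ U (w t) & forall r, 0 <= r < t -> U (w r)].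
Proof.
move=> cw; split=> [Tt|[t0 Ut tU]]; last first.
  apply/eqP; rewrite eq_le path_exit_le//=.
  apply: le_ereal_inf_tmp => _ [r [r0 Ur] <-]; rewrite lee_fin leNgt.
  by apply/negP => rt; apply: Ur; apply: tU; rewrite r0.
have t0 : 0 <= t by rewrite -lee_fin -Tt path_exit_ge0.
have before r : 0 <= r < t -> U (w r).
  move=> /andP[r0 rt]; apply: contrapT => Ur.
  by have := path_exit_le r0 Ur; rewrite Tt lee_fin leNgt rt.
split => // Ut.
have : \forall u \near t, U (w (Num.max 0 u)).
  by apply: (cw t); apply: open_nbhs_nbhs; split => //; rewrite max_r.
move=> /nbhs_ballP[e /= e0 eU].
have : (path_exit w < (t + e)%:E)%E by rewrite Tt lte_fin ltrDl.
move=> /ereal_inf_lt[_ [r [r0 Ur] <-]]; rewrite lte_fin => rte.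
have tr : t <= r by rewrite -lee_fin -Tt path_exit_le.
apply: Ur; rewrite -[r](max_r r0); apply: eU.
by rewrite /ball/= distrC ger0_norm ?subr_ge0// ltrBlDl.
Qed.

Lemma lt_path_exit w t : cont_path w -> 0 <= t ->
  (t%:E < path_exit w)%E <-> (forall r, 0 <= r <= t -> U (w r)).
Proof.
move=> cw t0; split=> [tT r /andP[r0 rt]|tU].
  apply: contrapT => Ur; have := path_exit_le r0 Ur.
  by move=> /(lt_le_trans tT); rewrite lte_fin ltNge rt.
case: (path_exit w) (path_exit_ge0 w) (fun s => (@path_exitP w s cw).1) => [s||//].
- rewrite lee_fin => s0 /(_ s erefl)[_ Us _]; rewrite lte_fin ltNge.
  by apply/negP => st; apply: Us; apply: tU; rewrite s0.
- by rewrite ltry.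
Qed.

(** The exit time of the shifted path is $T - t$; an equivalence about finite values avoids a
    subtraction from $+\infty$. *)
Lemma path_exit_shift w t s : cont_path w -> 0 <= t -> (t%:E < path_exit w)%E ->
  path_exit (shift t w) = s%:E <-> path_exit w = (t + s)%:E.
Proof.
move=> cw t0 /(lt_path_exit cw t0) tU.
have cs := cont_path_shift t0 cw.
split=> [/(path_exitP _ cs)[s0 Us sU]|/(path_exitP _ cw)[ts0 Uts tsU]].
  apply/(path_exitP _ cw); split => //; first by rewrite addr_ge0.
  move=> r /andP[r0 rts]; have [rt|tr] := leP r t; first by apply: tU; rewrite r0.
  by rewrite -[r](subrKC t); apply: sU; rewrite subr_ge0 ltW// ltrBlDl.
have s0 : 0 <= s.
  by rewrite leNgt; apply/negP => s0; apply: Uts; apply: tU; rewrite ts0 gerDl ltW.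
apply/(path_exitP _ cs); split => // r /andP[r0 rs].
by apply: tsU; rewrite addr_ge0//= ltrD2l.
Qed.

End exit.

(** * Exit from a segment: measurability and pathwise moments *)

Section exit_segment.
Variables (e : edge G) (a b : R).
Hypotheses (a0 : 0 < a) (bl : (b%:E < len e)%E).
Let U := seg e a b%:E.

Lemma open_seg : open U.
Proof.
rewrite /U segE ?ltW//; have /continuousP := @continuous_edge_coord _ _ e.
by apply; exact: interval_open.
Qed.

Lemma seg_coord z : U z <-> a < edge_coord e z < b.
Proof. by rewrite /U segE ?ltW//= in_itv. Qed.

(* On a compact time interval a continuous path which stays in the open segment
   stays in a closed one, and rational times suffice to see it. *)
Lemma lt_path_exit_rat w t : cont_path w -> 0 <= t ->
  (t%:E < path_exit U w)%E <-> exists n : nat, forall q : rat,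
    edge_coord e (w (Num.min t (Num.max 0 (ratr q))))
      \in `[a + n.+1%:R^-1, b - n.+1%:R^-1].
Proof.
move=> cw t0; rewrite (lt_path_exit open_seg cw t0).
pose f (u : R) := edge_coord e (w (Num.min t (Num.max 0 u))).
have cf : continuous f.
  move=> u; rewrite /f.
  have -> : (fun u => edge_coord e (w (Num.min t (Num.max 0 u)))) =
    edge_coord e \o ((fun u => w (Num.max 0 u)) \o (fun u => Num.min t (Num.max 0 u))).
    by apply/funext => v /=; rewrite (@max_r _ _ 0 (Num.min _ _))// le_min t0 le_max lexx.
  apply: continuous_comp; last exact: continuous_edge_coord.
  apply: continuous_comp; last exact: cw.
  exact: (@continuous_min R R (cst t) _ u (cvg_cst _) (@continuous_max0 u)).
have fE u : 0 <= u <= t -> f u = edge_coord e (w u).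
  by move=> /andP[u0 ut]; rewrite /f max_r// min_r.
split=> [tU|[n fn] r r0t].
  have cf' : {within `[0, t], continuous f} by exact: continuous_subspaceT.
  have [c1 c1t fc1] := EVT_max t0 cf'; have [c2 c2t fc2] := EVT_min t0 cf'.
  move: (c1t) (c2t); rewrite !in_itv/= => c1t' c2t'.
  have /seg_coord/andP[_ h1] := tU _ c1t'; have /seg_coord/andP[h2 _] := tU _ c2t'.
  rewrite -fE// in h1; rewrite -fE// in h2.
  (* The extrema of [f] on [[0, t]] lie strictly inside []a, b[]; [n] is chosen so that [n.+1%:R^-1]
     is below both margins. *)
  have e0 : 0 < Num.min (b - f c1) (f c2 - a) by rewrite lt_min !subr_gt0 h1.
  have [n _ nE] := near_infty_natSinv_lt (PosNum e0).
  have := nE n (leqnn n); rewrite /= lt_min => /andP[n1 n2].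
  exists n => q; rewrite -/(f (ratr q)).
  have [v vt ->] : exists2 v, v \in `[0, t] & f (ratr q) = f v.
    exists (Num.min t (Num.max 0 (ratr q))).
      by rewrite in_itv/= le_min t0 le_max lexx/= ge_min lexx.
    rewrite /f; congr (edge_coord e (w _)).
    rewrite [in RHS](@max_r _ _ 0); last by rewrite le_min t0 le_max lexx.
    by rewrite minA minxx.
  rewrite ltrBrDl in n1; rewrite ltrBrDl in n2.
  rewrite in_itv/= (le_trans (ltW n2) (fc2 _ vt))/= lerBrDr (le_trans _ (ltW n1))//.
  by rewrite lerD2r fc1.
apply/seg_coord; rewrite -fE//.
have : f r \in `[a + n.+1%:R^-1, b - n.+1%:R^-1].
  (* This preimage is closed and contains all rationals, which are dense, hence it also contains
     [r]. *)
  have cl : closed (f @^-1` `[a + n.+1%:R^-1, b - n.+1%:R^-1]).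
    by apply: closed_comp => //; exact: interval_closed.
  apply: cl => B /nbhs_interior/nbhs_singleton rB.
  have [y [qB [q _ qE]]] := @dense_rat R _ (ex_intro _ r rB) (open_interior B).
  move: qE qB => /[swap] qB qE; subst y.
  by exists (ratr q); split; [exact: fn|exact: interior_subset qB].
rewrite in_itv/=; have : 0 < n.+1%:R^-1 :> R by rewrite invr_gt0.
move: (n.+1%:R^-1) => i i0 /andP[h1 h2].
by rewrite (lt_le_trans _ h1) ?ltrDl// (le_lt_trans h2)// ltrBlDr ltrDl.
Qed.

Lemma measurable_path_exit : measurable_fun setT (path_exit U).
Proof.
apply: (measurability _ (ErealGenOInfty.measurableE R)) => _ [_ [r ->] <-].
rewrite setTI; have [r0|r0] := ltP r 0.
  rewrite (_ : _ @^-1` _ = setT)//; apply/seteqP; split => // w _ /=.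
  by rewrite in_itv/= andbT (lt_le_trans _ (path_exit_ge0 U w))// lte_fin.
apply/measurable_path_event.
have : measurable (\bigcup_n \bigcap_(q : rat) [set w : path_space |
    edge_coord e (w (Num.min r (Num.max 0 (ratr q))))
      \in `[a + n.+1%:R^-1, b - n.+1%:R^-1]]).
  apply: bigcupT_measurable => n; apply: countable_bigcapT_measurable => q.
  have rq0 : 0 <= Num.min r (Num.max 0 (ratr q)) by rewrite le_min r0 le_max lexx.
  have m := measurableT_comp (borel_continuous (@continuous_edge_coord _ _ e))
    (@measurable_path_coordinate (Num.min r (Num.max 0 (ratr q))) rq0).
  by have := m measurableT _ (measurable_itv `[a + n.+1%:R^-1, b - n.+1%:R^-1]); rewrite setTI.
move=> /measurable_path_event[B mB BE]; exists B => // w cw; rewrite -BE//.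
rewrite /= in_itv/= andbT; split=> [/lt_path_exit_rat-/(_ cw r0)[n nP]|[n _ nP]].
  by exists n => // q _; exact: nP.
by apply/(lt_path_exit_rat cw r0); exists n => q; exact: nP.
Qed.

(** The value [0] on discontinuous paths makes the function continuous in time for every path, as
    [measurable_caratheodory] requires. *)
Definition path_coord (p : measurableTypeR R * path_space) : R :=
  if `[< cont_path p.2 >] then edge_coord e (p.2 (Num.max 0 p.1)) else 0.

Lemma measurable_path_coord : measurable_fun setT path_coord.
Proof.
apply: (@measurable_caratheodory _ path_space R
  (fun s w => if `[< cont_path w >] then edge_coord e (w (Num.max 0 s)) else 0)).
  move=> s.
  apply: (@eq_cont_path_measurable_fun _ _ _ (fun w => edge_coord e (w (Num.max 0 s)))).
    by move=> w cw; rewrite asboolT.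
  apply: (measurableT_comp (borel_continuous (@continuous_edge_coord _ _ e))).
  by apply: measurable_path_coordinate; rewrite le_max lexx.
move=> w; have [cw|ncw] := pselect (cont_path w).
  under eq_fun do rewrite asboolT//.
  by move=> s; apply: (continuous_comp (cw s)); exact: continuous_edge_coord.
by under eq_fun do rewrite asboolF//; move=> s; exact: cvg_cst.
Qed.

Variable j : set (star G).

Definition path_exits : set path_space :=
  exits_through (fun t (w : path_space) => w t) U j.

Lemma closure_seg z : j `<=` U -> closure j z -> a <= edge_coord e z <= b.
Proof.
move=> jU; have : closed (edge_coord e @^-1` `[a, b]).
  by apply: closed_comp; [move=> ? _; exact: continuous_edge_coord|exact: interval_closed].
move=> /closure_id cl jz.
have : (edge_coord e @^-1` `[a, b]) z.
  rewrite cl; apply: closure_subset jz => y /jU/seg_coord /andP[ay yb].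
  by rewrite /= in_itv/= !ltW.
by rewrite /= in_itv.
Qed.

(** The exit point is at an end of the segment, being in the closure of [j] but not in the open
    segment. Membership in [closure j] thus becomes two constant propositions, and only the
    coordinate at the exit time depends on the path. *)
Lemma path_exitsE w : cont_path w -> path_exits w <->
  [/\ j `<=` U, (path_exit U w < +oo)%E &
     (closure j (pt e a) /\ path_coord (fine (path_exit U w), w) = a) \/
     (closure j (pt e b) /\ path_coord (fine (path_exit U w), w) = b)].
Proof.
move=> cw; rewrite /path_coord/= asboolT//.
split=> [[jU [t [Tt jt]]]|[jU Tf H]].
  have /(path_exitP open_seg _ cw)[t0 Ut _] := Tt.
  split=> //; first by rewrite /path_exit Tt ltry.
  rewrite /path_exit Tt/= max_r//.
  have /andP[h1 h2] := closure_seg jU jt.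
  have : edge_coord e (w t) = a \/ edge_coord e (w t) = b.
    have [/eqP|na] := eqVneq (edge_coord e (w t)) a; first by left; exact/eqP.
    right; apply/eqP; rewrite eq_le h2/= leNgt; apply/negP => wb; apply: Ut.
    by apply/seg_coord; rewrite wb andbT lt_neqAle eq_sym na.
  move=> [E|E]; [left|right]; split => //; rewrite -E.
  - by rewrite (pt_edge_coord _).1// E.
  - by rewrite (pt_edge_coord _).1// E (lt_le_trans a0)// -E (le_trans h1).
have Tfin : path_exit U w = (fine (path_exit U w))%:E.
  by rewrite fineK// ge0_fin_numE// path_exit_ge0.
split=> //; exists (fine (path_exit U w)); split => //.
have T0 : 0 <= fine (path_exit U w) by rewrite fine_ge0// path_exit_ge0.
move: H; rewrite max_r// => -[[jz E]|[jz E]].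
- by move: jz; rewrite -{1}E (pt_edge_coord _).1// E.
(* A point of [j] lies in the segment and gives [a < b], hence [0 < b], which is needed to recover
   the exit point from its coordinate. *)
- have : j !=set0.
    by apply/set0P/negP => /eqP j0; move: jz; rewrite j0 closure0.
  move=> [y /jU/seg_coord/andP[ay yb]].
  by move: jz; rewrite -{1}E (pt_edge_coord _).1// E (lt_trans a0)// (lt_trans ay).
Qed.

Lemma path_exits_fin w : path_exits w -> path_exit U w = (fine (path_exit U w))%:E.
Proof. by move=> [_ [t [Tt _]]]; rewrite /path_exit Tt. Qed.

Lemma measurable_path_exits : measurable path_exits.
Proof.
have mT := measurable_path_exit.
(* [fine] sends an infinite exit time to [0], which is harmless: the event below also asks for a
   finite exit time. *)
have mc : measurable_fun setT (fun w : path_space => path_coord (fine (path_exit U w), w)).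
  apply: (measurableT_comp measurable_path_coord).
  apply: measurable_fun_pair; last exact: measurable_id.
  by apply: measurableT_comp mT; exact: fine_measurable.
have mE : measurable [set w : path_space | 
    [/\ j `<=` U, (path_exit U w < +oo)%E &
     (closure j (pt e a) /\ path_coord (fine (path_exit U w), w) = a) \/
     (closure j (pt e b) /\ path_coord (fine (path_exit U w), w) = b)]].
  have mset (Q : Prop) : measurable [set w : path_space | Q].
    by have [q|q] := pselect Q;
      [rewrite (_ : [set _ | _] = setT)|rewrite (_ : [set _ | _] = set0)] => //;
      apply/seteqP; split.
  rewrite (_ : [set w | _] = [set _ | j `<=` U] `&`
     [set w | (path_exit U w < +oo)%E] `&` (
     ([set _ | closure j (pt e a)] `&` (fun w => path_coord (fine (path_exit U w), w)) @^-1` [set a]) `|`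
     ([set _ | closure j (pt e b)] `&` (fun w => path_coord (fine (path_exit U w), w)) @^-1` [set b]))); last first.
    by apply/seteqP; split => [w [? ? ?]|w [[? ?] ?]] //; split.
  apply: measurableI; first apply: measurableI => //.
    by rewrite -[X in measurable X]setTI; exact: emeasurable_fun_infty_o.
  by apply: measurableU; apply: measurableI => //;
    rewrite -[X in measurable X]setTI; apply: mc.
move: mE => /measurable_path_event[B mB BE].
apply/measurable_path_event; exists B => // w cw.
by rewrite -BE//; exact: path_exitsE.
Qed.

Lemma path_exits_shift w t : cont_path w -> 0 <= t -> (t%:E < path_exit U w)%E ->
  path_exits (shift t w) <-> path_exits w.
Proof.
move=> cw t0 tT; split=> -[jU [s [Ts js]]]; split => //.
  by exists (t + s); split => //; exact/(path_exit_shift open_seg s cw t0 tT).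
exists (s - t); rewrite /shift subrKC; split => //.
by apply/(path_exit_shift open_seg (s - t) cw t0 tT); rewrite subrKC.
Qed.

(** Real-valued, since the exit time is finite on the event and the indicator kills the product off
    it. *)
Definition path_moment (k : nat) (w : path_space) : R :=
  fine (path_exit U w) ^+ k * \1_path_exits w.

Lemma path_moment_ge0 k w : 0 <= path_moment k w.
Proof. by rewrite mulr_ge0// exprn_ge0// fine_ge0// path_exit_ge0. Qed.

Lemma path_momentE k w :
  (path_exit U w ^+ k * (\1_path_exits w)%:E)%E = (path_moment k w)%:E.
Proof.
rewrite /path_moment indicE; case: (boolP (w \in path_exits)) => [|_]; last by rewrite mule0 mulr0.
by rewrite inE => /path_exits_fin ->; rewrite /= mule1 mulr1 EFin_expe.
Qed.

Lemma measurable_path_moment k : measurable_fun setT (path_moment k).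
Proof.
apply: measurable_funM; last exact: measurable_indic measurable_path_exits.
apply: measurable_funX; apply: measurableT_comp measurable_path_exit.
exact: fine_measurable.
Qed.

Lemma path_moment_shift k w t : cont_path w -> 0 <= t -> (t%:E < path_exit U w)%E ->
  path_moment k (shift t w) = (fine (path_exit U w) - t) ^+ k * \1_path_exits w.
Proof.
move=> cw t0 tT; rewrite /path_moment !indicE.
have -> : (shift t w \in path_exits) = (w \in path_exits).
  by apply/idP/idP; rewrite !inE => /(path_exits_shift cw t0 tT).
case: (boolP (w \in path_exits)) => [|_]; last by rewrite !mulr0.
rewrite inE => /path_exits_fin Tf; rewrite !mulr1.
have -> : path_exit U (shift t w) = (fine (path_exit U w) - t)%:E.
  by apply/(path_exit_shift open_seg _ cw t0 tT); rewrite subrKC.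
by [].
Qed.

(** On the event, $T - t$ is the exit time of the path shifted by $t < T$ and the identity is the
    integral formula for $T^{k+1}$; off the event both sides vanish, because the shift does not
    change whether the path leaves through [j]. *)
Lemma integral_path_moment_shift k w : cont_path w ->
  (\int[lebesgue_measure]_(t in [set t : measurableTypeR R |
      (0 <= t)%R /\ (t%:E < path_exit U w)%E])
     (k.+1%:R * path_moment k (shift t w))%:E = (path_moment k.+1 w)%:E)%E.
Proof.
move=> cw; have [we|nwe] := pselect (path_exits w); last first.
  rewrite [path_moment k.+1 w]/path_moment indicE memNset// mulr0 integral0_eq// => t [t0 tT].
  by rewrite path_moment_shift// indicE memNset// !mulr0.
rewrite [path_moment k.+1 w]/path_moment indicE mem_set// mulr1.
have Tf := path_exits_fin we; set T := fine _ in Tf *.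
have T0 : 0 <= T by rewrite fine_ge0// path_exit_ge0.
rewrite -(integral_pow_co k T0).
have -> : [set t : measurableTypeR R | 0 <= t /\ (t%:E < path_exit U w)%E] = `[0, T[%classic.
  apply/seteqP; split => t /=; rewrite in_itv/= Tf lte_fin; first by move=> [-> ->].
  by move=> /andP.
apply: eq_integral => t; rewrite inE/= in_itv/= => /andP[t0 tT].
rewrite path_moment_shift//; last by rewrite Tf lte_fin.
by rewrite indicE mem_set// mulr1.
Qed.

End exit_segment.
End paths.

(** * The simple Markov property *)

Section lifetime_region.
Context {R : realType} {d : measure_display} {Om : measurableType d}.
Variables (Q : probability Om R) (S : Om -> \bar R).
Hypothesis mS : measurable_fun setT S.
Notation leb := (@lebesgue_measure R).

Definition before : set (measurableTypeR R * Om) :=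
  [set p | 0 <= p.1 /\ (p.1%:E < S p.2)%E].

Lemma measurable_before : measurable before.
Proof.
have -> : before = ((fun p => p.1) @^-1` `[0, +oo[) `&`
    [set p : measurableTypeR R * Om | (p.1%:E < S p.2)%E].
  by apply/seteqP; split => p; rewrite /before/= in_itv/= andbT.
apply: measurableI.
  rewrite -[X in measurable X]setTI.
  exact: (@measurable_fst _ _ (measurableTypeR R) Om).
rewrite -[X in measurable X]setTI; apply: measurable_lte => //.
  by apply/measurable_EFinP; exact: measurable_fst.
by apply: (measurableT_comp mS); exact: measurable_snd.
Qed.

Variable H : measurableTypeR R * Om -> \bar R.
Hypotheses (mH : measurable_fun setT H) (H0 : forall p, (0 <= H p)%E).

Let mHD : measurable_fun setT (H \_ before).
Proof.
by apply/(measurable_restrictT _ measurable_before); exact: measurable_funTS.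
Qed.

Let HD0 p : (0 <= (H \_ before) p)%E.
Proof. by rewrite patchE; case: ifP. Qed.

(** Slices at a fixed path: this order is for identities that hold path by path. *)
Lemma ge0_integral_before1 :
  (\int[leb \x Q]_(p in before) H p =
   \int[Q]_w \int[leb]_(t in [set t : measurableTypeR R | (0 <= t)%R /\ t%:E < S w])
     H (t, w))%E.
Proof.
rewrite integral_mkcond fubini_tonelli2//; apply: eq_integral => w _.
rewrite /fubini_G [RHS]integral_mkcond; apply: eq_integral => t _.
by rewrite !patchE; congr (if _ then _ else _); apply/idP/idP; rewrite !inE.
Qed.

(** Slices at a fixed time: this order is for the Markov property, applied on the event
    [t%:E < S w]. *)
Lemma ge0_integral_before2 :
  (\int[leb \x Q]_(p in before) H p =
   \int[leb]_(t in [set t : measurableTypeR R | (0 <= t)%R])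
     \int[Q]_(w in [set w | t%:E < S w]) H (t, w))%E.
Proof.
rewrite integral_mkcond fubini_tonelli1// [RHS]integral_mkcond.
apply: eq_integral => t _; rewrite /fubini_F [RHS]patchE.
case: (boolP (t \in _)) => [|tn]; rewrite ?inE.
  move=> t0; rewrite [RHS]integral_mkcond; apply: eq_integral => w _.
  rewrite !patchE; congr (if _ then _ else _); apply/idP/idP; rewrite !inE/before/=.
    by move=> [].
  by [].
rewrite integral0_eq// => w _; rewrite patchE ifF//; apply/negP; rewrite inE => -[t0 _].
by move/negP: tn; apply; rewrite inE.
Qed.

End lifetime_region.

Section process.
Context {R : realType} {G : star_graph R} {C : diffusion_coefs G}.
Context {d : measure_display} {Om : measurableType d}.
Variables (P : R.-pker (borel_star G) ~> Om) (X : R -> Om -> star G).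
Hypothesis hX : general_diffusion P X C.

(** [P z] under a name to which the structure of a probability measure is attached. *)
Definition law (z : star G) : set Om -> \bar R := P z.

HB.instance Definition _ z := Measure.on (law z).

Lemma law_setT z : law z setT = 1%E. Proof. exact: prob_kernel. Qed.

HB.instance Definition _ z := Measure_isProbability.Build _ _ _ (law z) (law_setT z).

Definition traj (t : R) (w : Om) : path_space := fun r => X (t + r) w.

Lemma traj0 w : traj 0 w = X^~ w.
Proof. by apply/funext => r; rewrite /traj add0r. Qed.

Lemma cont_path_process w : cont_path (X^~ w).
Proof. apply: cont_pathP; exact: process_continuous hX w. Qed.

Lemma cont_traj t w : 0 <= t -> cont_path (traj t w).
Proof. by move=> t0; exact (@cont_path_shift _ _ t (X^~ w) t0 (@cont_path_process w)). Qed.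

(** Trajectories being continuous, an event of [path_space] may be replaced by its representative in
    the sigma-algebra of coordinates, where the cylinders are enough. *)
Lemma measurable_traj t : 0 <= t -> measurable_fun setT (traj t).
Proof.
move=> t0 _ A /measurable_path_event[B mB AB]; rewrite setTI.
have -> : traj t @^-1` A = traj t @^-1` B.
  by apply/seteqP; split => w /=; move: (AB _ (@cont_traj t w t0)) => [].
pose cyl : set (set (R -> star G)) := [set B | exists (t : R) (A : set (borel_star G)),
         [/\ 0 <= t, measurable A & B = [set w | A (w t)]]].
have : measurable_fun setT (traj t : Om -> g_sigma_algebraType cyl).
  apply: (@measurability _ _ Om (g_sigma_algebraType cyl) setT (traj t) cyl erefl) => _ [_ [r [A' [r0 mA' ->]]] <-].
  exact: (process_measurable hX (addr_ge0 t0 r0)).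
by move=> /(_ measurableT B mB); rewrite setTI.
Qed.

Lemma measurable_process : measurable_fun setT ((fun w => X^~ w) : Om -> path_space).
Proof.
have -> : (fun w => X^~ w) = traj 0 by apply/funext => w; rewrite traj0.
exact: measurable_traj.
Qed.

Lemma past_measurable t A : past X t A -> measurable A.
Proof.
move: A; apply: smallest_sub; first exact: sigma_algebra_measurable.
move=> _ [s [B [/andP[s0 _] mB ->]]].
by rewrite -[X in measurable X]setTI; exact: (process_measurable hX s0).
Qed.

Lemma past_mono s t : s <= t -> past X s `<=` past X t.
Proof.
move=> st; apply: smallest_sub; first exact: smallest_sigma_algebra.
move=> _ [u [B [/andP[u0 us] mB ->]]]; apply: sub_sigma_algebra.
by exists u, B; split => //; rewrite u0 (le_trans us).
Qed.

Lemma past_set0T t (Q : Prop) : past X t [set _ | Q].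
Proof.
have [h0 hC _] := @smallest_sigma_algebra Om setT
  [set B | exists (s : R) (A : set (borel_star G)),
         [/\ 0 <= s <= t, measurable A & B = X s @^-1` A]].
have [q|q] := pselect Q.
  rewrite (_ : [set _ | _] = setT `\` set0); first exact: hC.
  by rewrite setD0; apply/seteqP; split.
by rewrite (_ : [set _ | _] = set0)//; apply/seteqP; split.
Qed.

(** The strong Markov property at the constant stopping time [t]. Both the shifted trajectories and
    those under the new law are continuous, so trace events are allowed. *)
Lemma simple_markov_set t A B x : 0 <= t -> past X t A -> path_event B ->
  (P x (A `&` (traj t @^-1` B)) = \int[P x]_(w in A) P (X t w) [set w | B (X^~ w)])%E.
Proof.
move=> t0 pA [B' mB' BB'].
have pI (u : R) (E F : set Om) : past X u E -> past X u F -> past X u (E `&` F).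
  move=> pE pF.
  exact: (@measurableI _ (g_sigma_algebraType [set B | exists (s : R) (A : set (borel_star G)),
         [/\ 0 <= s <= u, measurable A & B = X s @^-1` A]]) E F pE pF).
have st : stopping_time X (fun=> t%:E).
  by split => [w|u u0]; [rewrite lee_fin|exact: past_set0T].
have ps : past_stopped X (fun=> t%:E) A.
  move=> u u0; have [tu|ut] := leP t u.
    by apply: pI; [exact: past_mono pA|exact: past_set0T].
  rewrite (_ : A `&` _ = [set _ | False]); first exact: past_set0T.
  by apply/seteqP; split => // w [_ /=]; rewrite lee_fin leNgt ut.
have := process_strong_markov hX x st ps mB'.
rewrite /= (_ : A `&` [set w | (t%:E < +oo)%E] = A); last first.
  by apply/seteqP; split => [w []|w Aw] //; split => //=; rewrite ltry.
have -> : A `&` traj t @^-1` B = A `&` [set w | B' (fun r => X (t + r) w)].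
  by apply/seteqP; split => w [Aw /= h]; split => //; move: h;
    rewrite /traj => /(BB' _ (@cont_traj t w t0)).
move=> ->; apply: eq_integral => w _; congr (P _ _).
by apply/seteqP; split => w' /= /(BB' _ (@cont_path_process w')).
Qed.

Lemma measurable_expectation (Phi : path_space -> \bar R) :
  measurable_fun setT Phi -> (forall w, (0 <= Phi w)%E) ->
  measurable_fun setT (fun z : borel_star G => \int[P z]_w Phi (X^~ w))%E.
Proof.
move=> mPhi Phi0; apply: measurable_fun_integral_kernel => //.
  by move=> U mU; exact: measurable_kernel.
exact: (measurableT_comp mPhi measurable_process).
Qed.

Lemma simple_markov t A x (Phi : path_space -> \bar R) : 0 <= t -> past X t A ->
  measurable_fun setT Phi -> (forall w, (0 <= Phi w)%E) ->
  (\int[P x]_(w in A) Phi (traj t w) =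
   \int[P x]_(w in A) \int[P (X t w)]_w' Phi (X^~ w'))%E.
Proof.
move=> t0 pA; have mA := past_measurable pA; have mt := measurable_traj t0.
have mX : measurable_fun setT (X t : Om -> borel_star G) by exact: (process_measurable hX t0).
have m1 (Psi : path_space -> \bar R) : measurable_fun setT Psi -> measurable_fun A (fun w => Psi (traj t w)).
  by move=> mPsi; apply: measurable_funTS; exact: (measurableT_comp mPsi mt).
have mw (Psi : path_space -> \bar R) : measurable_fun setT Psi -> measurable_fun setT (fun w => Psi (X^~ w)).
  by move=> mPsi; exact: (measurableT_comp mPsi measurable_process).
have m2 (Psi : path_space -> \bar R) : measurable_fun setT Psi -> (forall w, (0 <= Psi w)%E) ->
    measurable_fun A (fun w => \int[P (X t w)]_w' Psi (X^~ w'))%E.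
  move=> mPsi Psi0; apply: measurable_funTS.
  exact: (measurableT_comp (measurable_expectation mPsi Psi0) mX).
move: Phi; apply: ge0_measurable_ind.
- move=> B mB; have eB := (measurable_path_event B).1 mB.
  transitivity (P x (A `&` (traj t @^-1` B))).
    rewrite (_ : (fun w => (\1_B (traj t w))%:E) = (fun w => (\1_(traj t @^-1` B) w)%:E))//.
    rewrite integral_indic// 1?setIC//.
    by rewrite -[X in measurable X]setTI; exact: mt.
  rewrite simple_markov_set//; apply: eq_integral => w _.
  rewrite -(setIT [set w | B _]) -integral_indic//.
  by rewrite -[X in measurable X]setTI; exact: measurable_process.
- move=> c f c0 mf f0 IH.
  rewrite ge0_integralZl_EFin//; last exact: m1.
  rewrite IH -ge0_integralZl_EFin//; last 2 first.
  - by move=> w _; exact: integral_ge0.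
  - exact: m2.
  apply: eq_integral => w _; rewrite ge0_integralZl_EFin//; exact: mw.
- move=> f g mf mg f0 g0 If Ig.
  rewrite ge0_integralD//; [|exact: m1|exact: m1].
  rewrite If Ig -ge0_integralD//; last 4 first.
  - by move=> w _; exact: integral_ge0.
  - exact: m2.
  - by move=> w _; exact: integral_ge0.
  - exact: m2.
  by apply: eq_integral => w _; rewrite ge0_integralD//; exact: mw.
- move=> F f mF mf F0 ndF Ff IH.
  have f0 w : (0 <= f w)%E.
    rewrite -(cvg_lim _ (Ff w))//; apply: lime_ge; first by apply/cvg_ex; eexists; exact: Ff.
    by near=> n; exact: F0.
  have c1 : (\int[P x]_(w in A) F n (traj t w))%E @[n --> \oo] -->
      (\int[P x]_(w in A) f (traj t w))%E.
    apply: (@nondecreasing_cvg_integral _ _ _ (P x) A (fun n w => F n (traj t w))) => //.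
    by move=> n; exact: m1.
  have c2 : (\int[P x]_(w in A) \int[P (X t w)]_w' F n (X^~ w'))%E @[n --> \oo] -->
      (\int[P x]_(w in A) \int[P (X t w)]_w' f (X^~ w'))%E.
    apply: (@nondecreasing_cvg_integral _ _ _ (P x) A
      (fun n w => \int[P (X t w)]_w' F n (X^~ w'))%E) => //.
    - by move=> n; exact: m2.
    - by move=> n w _; exact: integral_ge0.
    - by move=> w _ m n mn; apply: ge0_le_integral => //;
        [exact: mw|exact: mw|move=> w' _; exact: ndF].
    - move=> w _.
      apply: (@nondecreasing_cvg_integral _ _ _ (P (X t w)) setT
        (fun n w' => F n (X^~ w'))) => //.
      by move=> n; exact: mw.
  rewrite -(cvg_lim _ c1)// -(cvg_lim _ c2)//.
  by congr (limn _); apply/funext => n; exact: IH.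
Unshelve. all: by end_near. Qed.

Lemma measurable_start z : measurable [set w | X 0 w = z].
Proof.
have m1 : measurable ([set z] : set (borel_star G)).
  rewrite -[X in measurable X]setCK; apply: measurableC; apply: sub_sigma_algebra.
  apply: closed_openC; apply: accessible_closed_set1.
  exact/hausdorff_accessible/metric_hausdorff.
by have := process_measurable hX (lexx 0) measurableT m1; rewrite setTI.
Qed.

Lemma law_startC z : law z (~` [set w | X 0 w = z]) = 0%E.
Proof.
have := @probability_setC _ _ _ (law z) _ (measurable_start z).
rewrite [X in (1 - X)%E](_ : _ = 1%E); last exact: (process_start hX z).
by rewrite subee.
Qed.

End process.

(** * Moments of the exit time *)

Section exit_process.
Context {R : realType} {G : star_graph R} {C : diffusion_coefs G}.
Context {d : measure_display} {Om : measurableType d}.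
Variables (P : R.-pker (borel_star G) ~> Om) (X : R -> Om -> star G).
Hypothesis hX : general_diffusion P X C.
Variables (e : edge G) (a b : R).
Hypotheses (a0 : 0 < a) (bl : (b%:E < len e)%E).
Notation leb := (@lebesgue_measure R).

Definition exit_of (w : Om) : \bar R := path_exit (seg e a b%:E) (X^~ w).

Definition process_coord (p : measurableTypeR R * Om) : R :=
  path_coord e (p.1, X^~ p.2).

Lemma exit_of_ge0 w : (0 <= exit_of w)%E.
Proof. exact: path_exit_ge0. Qed.

Lemma measurable_exit_of : measurable_fun setT exit_of.
Proof.
exact: (measurableT_comp (measurable_path_exit a0 bl) (measurable_process hX)).
Qed.

(** The rational description of [t < T] caps all times at [t], so the event is in the past of [t],
    where the Markov property can be applied. *)
Lemma past_before_exit t : 0 <= t -> past X t [set w | (t%:E < exit_of w)%E].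
Proof.
move=> t0.
pose past_type := g_sigma_algebraType [set B | exists (s : R) (A : set (borel_star G)),
         [/\ 0 <= s <= t, measurable A & B = X s @^-1` A]].
have : measurable (\bigcup_n \bigcap_(q : rat) [set w : past_type |
    edge_coord e (X (Num.min t (Num.max 0 (ratr q))) w)
      \in `[a + n.+1%:R^-1, b - n.+1%:R^-1]]).
  apply: bigcupT_measurable => n; apply: countable_bigcapT_measurable => q.
  apply: sub_sigma_algebra; exists (Num.min t (Num.max 0 (ratr q))).
  exists (edge_coord e @^-1` `[a + n.+1%:R^-1, b - n.+1%:R^-1]); split => //.
    by rewrite le_min t0 le_max lexx ge_min lexx.
  have := borel_continuous (@continuous_edge_coord _ _ e) measurableT
    (measurable_itv `[a + n.+1%:R^-1, b - n.+1%:R^-1]).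
  by rewrite setTI.
rewrite (_ : \bigcup_n _ = [set w | (t%:E < exit_of w)%E])//.
apply/seteqP; split => w /=.
  move=> [n _ nP]; apply/(lt_path_exit_rat a0 bl (cont_path_process hX (w := w)) t0).
  by exists n => q; exact: nP.
move=> /(lt_path_exit_rat a0 bl (cont_path_process hX (w := w)) t0)[n nP].
by exists n => // q _; exact: nP.
Qed.

Lemma process_coordE t w : 0 <= t -> process_coord (t, w) = edge_coord e (X t w).
Proof.
move=> t0; rewrite /process_coord /path_coord asboolT; first by rewrite /= max_r.
exact: (cont_path_process hX).
Qed.

Lemma measurable_process_coord : measurable_fun setT process_coord.
Proof.
apply: (measurableT_comp (@measurable_path_coord _ _ e)).
apply: measurable_fun_pair; first exact: measurable_fst.
by apply: (measurableT_comp (measurable_process hX)); exact: measurable_snd.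
Qed.

Lemma before_exit_coord t w : 0 <= t -> (t%:E < exit_of w)%E ->
  [/\ a < process_coord (t, w), process_coord (t, w) < b &
      X t w = pt e (process_coord (t, w))].
Proof.
move=> t0 /(lt_path_exit (open_seg a0 bl) (cont_path_process hX (w := w)) t0).
move=> /(_ t); rewrite t0 lexx => /(_ isT)/(seg_coord a0 bl)/andP[h1 h2].
rewrite process_coordE//; split => //.
by rewrite (pt_edge_coord _).1// (lt_trans a0).
Qed.

Variable j : set (star G).
Let v := exit_moment P X (seg e a b%:E) j.

Lemma exit_momentE k z :
  v k z = (\int[law P z]_w (path_moment e a b j k (X^~ w))%:E)%E.
Proof.
rewrite /v /exit_moment; apply: eq_integral => w _.
exact: (path_momentE e a b j k (X^~ w)).
Qed.

Lemma exit_moment_ge0 k z : (0 <= v k z)%E.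
Proof.
by rewrite exit_momentE; apply: integral_ge0 => w _; rewrite lee_fin path_moment_ge0.
Qed.

Let mPhi k : measurable_fun setT (fun w : path_space => (path_moment e a b j k w)%:E).
Proof. by apply/measurable_EFinP; exact: measurable_path_moment. Qed.

Lemma measurable_exit_moment k : measurable_fun setT (v k : borel_star G -> \bar R).
Proof.
have -> : v k = (fun z => \int[P z]_w (path_moment e a b j k (X^~ w))%:E)%E.
  by apply/funext => z; exact: exit_momentE.
apply: (measurable_expectation hX (mPhi k)) => w.
by rewrite lee_fin path_moment_ge0.
Qed.

(** Before the exit, [v k] is only evaluated on the segment. The restriction is a function on the
    whole line, of the kind integrated in [green_occupation]. *)
Lemma measurable_exit_moment_pt k :
  measurable_fun setT ((fun y => v k (pt e y)) \_ `]a, b[%classic : R -> \bar R).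
Proof.
apply/(measurable_restrictT _ (measurable_itv _)).
exact: (measurable_comp measurableT (@subsetT _ _) (measurable_exit_moment k)
  (borel_pt (ltW a0) bl)).
Qed.

(* By the Markov property at the time [t], the [k]-th moment of the remaining
   life [exit_of - t] integrates to [v k (X t)], and
   [T ^ k.+1 = int_0^T (k + 1) (T - t) ^ k dt]. *)
Lemma exit_moment_occupation k z : (v k.+1 z = k.+1%:R%:E *
  \int[leb \x law P z]_(p in before exit_of)
    (((fun y => v k (pt e y)) \_ `]a, b[%classic) (process_coord p)))%E.
Proof.
pose V := (fun y => v k (pt e y)) \_ `]a, b[%classic.
have mV : measurable_fun setT (fun p : measurableTypeR R * Om => V (process_coord p)).
  exact: (measurableT_comp (measurable_exit_moment_pt k) measurable_process_coord).
have V0 p : (0 <= V p)%E.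
  by rewrite /V patchE; case: ifP => // _; exact: exit_moment_ge0.
(* The absolute value makes [H] nonnegative everywhere, as Tonelli's theorem requires; on
   [before exit_of] and on the event, it is the absolute value of a nonnegative number. *)
pose H (p : measurableTypeR R * Om) : \bar R :=
  (k.+1%:R * (`|fine (exit_of p.2) - p.1| ^+ k * \1_(path_exits e a b j) (X^~ p.2)))%:E.
have mH : measurable_fun setT H.
  apply/measurable_EFinP; apply: measurable_funM; first exact: measurable_cst.
  apply: measurable_funM.
    apply: measurable_funX; apply: measurableT_comp => //.
    apply: measurable_funB; last exact: measurable_fst.
    apply: (measurableT_comp (fine_measurable measurableT)).
    by apply: (measurableT_comp measurable_exit_of); exact: measurable_snd.
  apply: (measurableT_comp (measurable_indic (measurable_path_exits a0 bl j))).
  by apply: (measurableT_comp (measurable_process hX)); exact: measurable_snd.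
have H0 p : (0 <= H p)%E by rewrite lee_fin !mulr_ge0.
have HE t w : 0 <= t -> (t%:E < exit_of w)%E ->
    H (t, w) = (k.+1%:R * path_moment e a b j k (traj X t w))%:E.
  move=> t0 tT; have cw := cont_path_process hX (w := w).
  rewrite /H/= (path_moment_shift a0 bl j k cw t0 tT) -/(exit_of w).
  have [we|nwe] := pselect (path_exits e a b j (X^~ w)); last first.
    by rewrite !indicE memNset// !mulr0.
  have := path_exits_fin we; rewrite -/(exit_of w) => Tf.
  by rewrite ger0_norm// subr_ge0 ltW// -lte_fin -Tf.
(* Path by path, the inner integral in time is the one of [integral_path_moment_shift]. *)
have leqH : (v k.+1 z = \int[leb \x law P z]_(p in before exit_of) H p)%E.
  rewrite ge0_integral_before1//; last exact: measurable_exit_of.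
  rewrite exit_momentE; apply: eq_integral => w _.
  rewrite -(integral_path_moment_shift a0 bl j k (cont_path_process hX (w := w))).
  by apply: eq_integral => t; rewrite inE => -[t0 tT]; rewrite -HE.
rewrite leqH -ge0_integralZl_EFin//; last 2 first.
- by apply: measurable_before; exact: measurable_exit_of.
- exact: measurable_funTS.
(* Now time by time, so as to condition on the past of [t]. *)
rewrite !ge0_integral_before2//; [|exact: measurable_exit_of|
  by apply: measurable_funeM|by move=> p; rewrite mule_ge0|exact: measurable_exit_of].
apply: eq_integral => t; rewrite inE/= => t0.
have pA := past_before_exit t0; have mA := past_measurable hX pA.
transitivity (k.+1%:R%:E * \int[P z]_(w in [set w | t%:E < exit_of w])
    (path_moment e a b j k (traj X t w))%:E)%E.
  rewrite -ge0_integralZl_EFin//; last 2 first.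
  - by move=> w _; rewrite lee_fin path_moment_ge0.
  - apply: measurable_funTS; exact: (measurableT_comp (mPhi k) (measurable_traj hX t0)).
  by apply: eq_integral => w; rewrite inE => tT; rewrite HE// EFinM.
rewrite (simple_markov hX z t0 pA (mPhi k)); last first.
  by move=> w; rewrite lee_fin path_moment_ge0.
have mXt : measurable_fun setT (X t : Om -> borel_star G) by exact: (process_measurable hX t0).
have mvX : measurable_fun setT (fun w => v k (X t w)).
  exact: (measurableT_comp (measurable_exit_moment k) mXt).
rewrite -ge0_integralZl_EFin//; last 2 first.
- by move=> w _; apply: integral_ge0 => w' _; rewrite lee_fin path_moment_ge0.
- apply: (@eq_measurable_fun _ _ _ _ _ (fun w => v k (X t w))).
    by move=> w _; rewrite exit_momentE.
  exact: measurable_funTS.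
apply: eq_integral => w; rewrite inE => tT; congr (_ * _)%E.
have [ax xb XE] := before_exit_coord t0 tT.
rewrite -[LHS]/(\int[law P (X t w)]_w' (path_moment e a b j k (X^~ w'))%:E)%E -exit_momentE.
by rewrite /V patchE mem_set ?XE//= in_itv/= ax.
Qed.

End exit_process.

(** * Dynkin's formula *)

Lemma lebesgue_measure_co0 (R : realType) (s : \bar R) : (0 <= s)%E ->
  (@lebesgue_measure R) [set t : measurableTypeR R | (0 <= t)%R /\ (t%:E < s)%E] = s.
Proof.
move=> s0; have -> : [set t : measurableTypeR R | (0 <= t)%R /\ (t%:E < s)%E] =
    [set` Interval (BLeft 0) (if s is r%:E then BLeft r else +oo%O)].
  case: s s0 => [r||//] _; apply/seteqP; split => t /=; rewrite in_itv/= ?lte_fin ?ltry ?andbT.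
  - by move=> [-> ->].
  - by move=> /andP.
  - by move=> [].
  - by move=> t0; split.
case: s s0 => [r||//]; rewrite ?lee_fin => r0; rewrite lebesgue_measure_itv/= ?lte_fin ?ltry//.
by case: ltgtP r0 => // [_|<-]; rewrite ?sube0.
Qed.

Section measure_lifetime_region.
Context {R : realType} {d : measure_display} {Om : measurableType d}.
Variables (Q : probability Om R) (S : Om -> \bar R).
Hypotheses (mS : measurable_fun setT S) (S0 : forall w, (0 <= S w)%E).

(** The expectation of the lifetime is the area below its graph. This gives a finite region when the
    lifetime is bounded, and later a bound on the truncated exit time. *)
Lemma measure_before :
  ((@lebesgue_measure R \x Q) (before S) = \int[Q]_w S w)%E.
Proof.
have mB := measurable_before mS.
rewrite -[LHS]mul1e -integral_cst// ge0_integral_before1//.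
apply: eq_integral => w _.
have mw : measurable [set t : measurableTypeR R | (0 <= t)%R /\ (t%:E < S w)%E].
  rewrite (_ : [set t | _] = ysection (before S) w); first exact: measurable_ysection.
  by apply/seteqP; split => t; rewrite /ysection/= inE.
by rewrite integral_cst// mul1e; exact: lebesgue_measure_co0.
Qed.

End measure_lifetime_region.

Section dynkin.
Context {R : realType} {G : star_graph R} {C : diffusion_coefs G}.
Context {d : measure_display} {Om : measurableType d}.
Variables (P : R.-pker (borel_star G) ~> Om) (X : R -> Om -> star G).
Hypothesis hX : general_diffusion P X C.
Variables (e : edge G) (a b : R).
Hypotheses (a0 : 0 < a) (bl : (b%:E < len e)%E).
Notation leb := (@lebesgue_measure R).
Variables (N : R) (z : star G).
Hypothesis N0 : 0 <= N.

Definition exit_upto (w : Om) : \bar R := Order.min (exit_of X e a b w) N%:E.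

Let sig w : R := fine (exit_upto w).

Lemma exit_upto_fin w : exit_upto w = (sig w)%:E.
Proof.
rewrite /sig fineK// ge0_fin_numE; first by rewrite gt_min ltry orbT.
by rewrite le_min exit_of_ge0 lee_fin.
Qed.

Lemma exit_upto_bounds w : 0 <= sig w <= N.
Proof.
rewrite -!lee_fin -exit_upto_fin le_min exit_of_ge0 lee_fin N0/=.
by rewrite ge_min lexx orbT.
Qed.

Lemma measurable_exit_upto : measurable_fun setT exit_upto.
Proof.
apply: measurable_mine; first exact: (measurable_exit_of hX a0 bl).
exact: measurable_cst.
Qed.

Let m := (leb \x law P z)%E.
Let D := before exit_upto.

Let mD : measurable D. Proof. exact: measurable_before measurable_exit_upto. Qed.

Lemma before_exit_upto_lty : (m D < +oo)%E.
Proof.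
rewrite /m measure_before; [|exact: measurable_exit_upto|]; last first.
  by move=> w; rewrite exit_upto_fin lee_fin; have /andP[] := exit_upto_bounds w.
apply: (@le_lt_trans _ _ (\int[law P z]_w N%:E)%E); last first.
  rewrite integral_cst//.
  by rewrite -[X in (X < _)%E]/(N%:E * law P z setT)%E law_setT mule1 ltry.
apply: ge0_le_integral => //.
- by move=> w _; rewrite exit_upto_fin lee_fin; have /andP[] := exit_upto_bounds w.
- exact: measurable_exit_upto.
- by move=> w _; rewrite exit_upto_fin lee_fin; have /andP[] := exit_upto_bounds w.
Qed.

Lemma past_before_exit_upto t : 0 <= t -> past X t [set w | (t%:E < exit_upto w)%E].
Proof.
move=> t0; have [tN|Nt] := ltP t N.
  rewrite (_ : [set w | _] = [set w | (t%:E < exit_of X e a b w)%E]).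
    exact: (past_before_exit hX a0 bl t0).
  by apply/seteqP; split => w /=; rewrite /exit_upto lt_min lte_fin tN andbT.
rewrite (_ : [set w | _] = [set _ | False]); first exact: past_set0T.
by apply/seteqP; split => w //=; rewrite /exit_upto lt_min lte_fin (ltNge t) Nt andbF.
Qed.

Section bounded_function.
Variables (f : star G -> R) (M : R).
Hypotheses (cf : continuous f) (f0 : forall y, 0 <= f y) (fM : forall y, f y <= M).

Let phi w (u : R) : R := f (X (Num.max 0 u) w).

Let cphi w : continuous (phi w).
Proof.
move=> u; apply: (@cvg_comp _ _ _ (fun u : R => X (Num.max 0 u) w) f _
  (nbhs (X (Num.max 0 u) w))); last exact: cf.
exact: (cont_path_process hX (w := w)).
Qed.

Lemma measurable_path_function h : 0 <= h ->
  measurable_fun setT (fun p : measurableTypeR R * Om => phi p.2 (p.1 + h)).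
Proof.
move=> h0; apply: (@measurable_caratheodory _ Om R (fun s w => phi w (s + h))).
  move=> s; apply: (measurableT_comp (borel_continuous cf)).
  by apply: (process_measurable hX); rewrite le_max lexx.
move=> w s; apply: (@cvg_comp _ _ _ (fun t => t + h) (phi w) _ (nbhs (s + h))).
  by apply: cvgD => //; exact: cvg_cst.
exact: cphi.
Qed.

Lemma transition_semigroupE h y : 0 <= h ->
  (transition_semigroup P X h f y)%:E = (\int[P y]_w (f (X h w))%:E)%E.
Proof.
move=> h0; rewrite /transition_semigroup /Rintegral fineK//.
apply: integrable_fin_num => //; apply: (@bounded_integrable _ _ _ (P y) setT (fun w => f (X h w)) M) => //.
- by rewrite -[X in (X < _)%E]/(law P y setT) law_setT ltry.
- apply: (measurableT_comp (borel_continuous cf)); exact: (process_measurable hX).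
- by move=> w _; rewrite ger0_norm.
Qed.

Lemma measurable_semigroup_coord h : 0 <= h -> measurable_fun D
  (fun p => transition_semigroup P X h f (pt e (process_coord X e p))).
Proof.
move=> h0; have mP : measurable_fun setT (transition_semigroup P X h f : borel_star G -> R).
  apply/measurable_EFinP; rewrite /comp; under eq_fun do rewrite transition_semigroupE//.
  apply: measurable_fun_integral_kernel => //.
  - by move=> U mU; exact: measurable_kernel.
  - by move=> w; rewrite lee_fin.
  - apply/measurable_EFinP; apply: (measurableT_comp (borel_continuous cf)).
    exact: (process_measurable hX).
apply: (measurableT_comp mP).
apply: (measurable_comp (measurable_itv `]a, b[) _ (borel_pt (ltW a0) bl)); last first.
  by apply: measurable_funTS; exact: (measurable_process_coord hX).
move=> _ [[t w] [/= t0 tS] <-]; move: tS; rewrite lt_min => /andP[tT _].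
by have [h1 h2 _] := before_exit_coord hX a0 bl t0 tT; rewrite /= in_itv/= h1.
Qed.

(** The Markov property at each time [t], on the event [t%:E < exit_upto w], which belongs to the
    past of [t]. *)
Lemma integral_semigroup_coord h : 0 <= h ->
  (\int[m]_(p in D) (transition_semigroup P X h f (pt e (process_coord X e p)))%:E =
   \int[m]_(p in D) (phi p.2 (p.1 + h))%:E)%E.
Proof.
move=> h0; have mS := measurable_exit_upto.
have sg0 y : 0 <= transition_semigroup P X h f y.
  by rewrite /transition_semigroup Rintegral_ge0.
(* Extended by zero off [D], to have a function that is measurable on the whole product. *)
pose F := (fun p => (transition_semigroup P X h f (pt e (process_coord X e p)))%:E) \_ D.
have mF : measurable_fun setT F.
  apply/(measurable_restrictT _ mD); apply/measurable_EFinP.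
  exact: measurable_semigroup_coord.
transitivity (\int[m]_(p in D) F p)%E.
  by apply: eq_integral => p pD; rewrite /F patchE pD.
rewrite !ge0_integral_before2//.
- apply: eq_integral => t; rewrite inE/= => t0.
  have pA := past_before_exit_upto t0.
  have mPhi : measurable_fun setT (fun w : path_space => (f (w h))%:E).
    apply/measurable_EFinP; apply: (measurableT_comp (borel_continuous cf)).
    exact: measurable_path_coordinate.
  have := simple_markov hX z t0 pA mPhi (fun w => _).
  rewrite /law => E; transitivity (\int[P z]_(w in [set w | t%:E < exit_upto w])
      (f (traj X t w h))%:E)%E.
    rewrite E; last by move=> w; rewrite lee_fin.
    apply: eq_integral => w; rewrite inE/= => tS.
    have tD : (t, w) \in D by rewrite inE; split.
    rewrite /F patchE tD.
    move: tS; rewrite lt_min => /andP[tT _].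
    have [_ _ <-] := before_exit_coord hX a0 bl t0 tT.
    by rewrite transition_semigroupE.
  apply: eq_integral => w _; rewrite /phi /traj max_r//.
  by rewrite addr_ge0.
- by apply/measurable_EFinP; exact: measurable_path_function.
- by move=> p; rewrite lee_fin; exact: f0.
- by move=> p; rewrite /F patchE; case: ifP => // _; rewrite lee_fin.
Qed.

Let A h w : R := \int[leb]_(t in `[0%R, sig w[) phi w (t + h).

Lemma integral_path_function h : 0 <= h ->
  [/\ (\int[m]_(p in D) (phi p.2 (p.1 + h))%:E = \int[law P z]_w (A h w)%:E)%E,
      measurable_fun setT (A h) & forall w, `|A h w| <= M * N].
Proof.
move=> h0; have mS := measurable_exit_upto.
have mphi := measurable_path_function h0.
have M0 : 0 <= M by exact: le_trans (f0 z) (fM z).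
have setE w : [set t : measurableTypeR R | (0 <= t)%R /\ (t%:E < exit_upto w)%E] = `[0%R, sig w[%classic.
  apply/seteqP; split => t /=; rewrite in_itv/= exit_upto_fin lte_fin; first by move=> [-> ->].
  by move=> /andP.
have mph w : measurable_fun `[0%R, sig w[ (fun t => phi w (t + h)).
  by apply: measurable_funTS; exact: (measurableT_comp mphi (@pair2_measurable _ _ (measurableTypeR R) Om w)).
have AE w : (A h w)%:E = (\int[leb]_(t in `[0%R, sig w[) (phi w (t + h))%:E)%E.
  rewrite /A /Rintegral fineK//; apply: integrable_fin_num => //.
  apply: (@bounded_integrable _ _ _ leb _ (fun t => phi w (t + h)) M) => //.
  - rewrite -[X in (X < _)%E]/(leb `[0%R, sig w[%classic) lebesgue_measure_itv/=; case: ifP => // _.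
    by rewrite -EFinB ltry.
  - exact: mph.
  - by move=> t _; rewrite ger0_norm; [exact: fM|exact: f0].
have A0 w : 0 <= A h w by apply: Rintegral_ge0 => t _; exact: f0.
have AEm : (fun w => (A h w)%:E) = (fun w => \int[leb]_t
   ((fun p : measurableTypeR R * Om => (phi p.2 (p.1 + h))%:E) \_ D) (t, w))%E.
  apply/funext => w; rewrite AE -setE integral_mkcond; apply: eq_integral => t _.
  by rewrite !patchE; congr (if _ then _ else _); apply/idP/idP; rewrite !inE.
split.
- rewrite ge0_integral_before1//; last 2 first.
  + exact/measurable_EFinP.
  + by move=> p; rewrite lee_fin; exact: f0.
  by apply: eq_integral => w _; rewrite AE setE.
- apply/measurable_EFinP; rewrite /comp AEm.
  apply: (measurable_fun_fubini_tonelli_G (m1 := leb)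
    ((fun p : measurableTypeR R * Om => (phi p.2 (p.1 + h))%:E) \_ D)).
  + apply/(measurable_restrictT _ mD); apply: measurable_funTS; exact/measurable_EFinP.
  + by move=> p; rewrite patchE; case: ifP => // _; rewrite lee_fin; exact: f0.
- move=> w; rewrite ger0_norm// -lee_fin AE.
  have /andP[s0 sN] := exit_upto_bounds w.
  apply: (@le_trans _ _ (\int[leb]_(t in `[0%R, sig w[) M%:E)%E).
    apply: ge0_le_integral => //.
    + by move=> t _; rewrite lee_fin; exact: f0.
    + by apply/measurable_EFinP; exact: mph.
    + by move=> t _; rewrite lee_fin; exact: fM.
  rewrite integral_cst// -[X in (X <= _)%E]/(M%:E * leb `[0%R, sig w[%classic)%E.
  rewrite lebesgue_measure_itv/= lte_fin.
  case: ltP => [_|_]; last by rewrite mule0 lee_fin mulr_ge0.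
  by rewrite sube0 -EFinM lee_fin ler_wpM2l.
Qed.

Lemma path_function_increment h w : 0 <= h ->
  A h w - A 0 w = \int[leb]_(t in `[0%R, sig w[) (phi w (t + h) - phi w t).
Proof.
move=> h0; have integ u : 0 <= u -> leb.-integrable `[0%R, sig w[ (EFin \o (fun t => phi w (t + u))).
  move=> u0; apply: (@bounded_integrable _ _ _ leb _ (fun t => phi w (t + u)) M) => //.
  - rewrite -[X in (X < _)%E]/(leb `[0%R, sig w[%classic) lebesgue_measure_itv/=; case: ifP => // _.
    by rewrite -EFinB ltry.
  - apply: measurable_funTS.
    exact: (measurableT_comp (measurable_path_function u0) (@pair2_measurable _ _ (measurableTypeR R) Om w)).
  - by move=> t _; rewrite ger0_norm; [exact: fM|exact: f0].
rewrite /A -RintegralB//; [|exact: integ|exact: integ].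
by apply: eq_Rintegral => t _; rewrite addr0.
Qed.

Variable g : star G -> R.
Hypothesis fg : infinitesimal_generator P X f g.

Let q h y := (transition_semigroup P X h f y - f y) / h.

(** Both sides are the quotient by [h] of the integrals of $f(X_{t+h})$ and of $f(X_t)$ over [D]. As
    [D] has finite measure and [f] is bounded, the integrals are finite and can be subtracted. *)
Let increment_integral h : 0 < h ->
  (\int[m]_(p in D) (q h (pt e (process_coord X e p)))%:E =
   \int[law P z]_w (h^-1 * (A h w - A 0 w))%:E)%E.
Proof.
move=> h0; have h0' := ltW h0.
have M0 : 0 <= M by exact: le_trans (f0 z) (fM z).
have [Ih mAh bAh] := integral_path_function h0'.
have [I0 mA0 bA0] := integral_path_function (lexx 0).
have Pf0 y : 0 <= transition_semigroup P X h f y.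
  by rewrite /transition_semigroup Rintegral_ge0.
have PfM y : transition_semigroup P X h f y <= M.
  rewrite -lee_fin transition_semigroupE//.
  apply: (@le_trans _ _ (\int[law P y]_w M%:E)%E).
    apply: ge0_le_integral => //.
    - by move=> w _; rewrite lee_fin.
    - apply/measurable_EFinP; apply: (measurableT_comp (borel_continuous cf)).
      exact: (process_measurable hX).
    - by move=> w _; rewrite lee_fin.
  rewrite integral_cst//.
  by rewrite -[X in (X <= _)%E]/(M%:E * law P y setT)%E law_setT mule1.
have mu := measurable_semigroup_coord h0'.
have mv := measurable_path_function (lexx 0).
have iu : m.-integrable D (EFin \o (fun p => transition_semigroup P X h f (pt e (process_coord X e p)))).
  apply: (@bounded_integrable _ _ _ m D _ M) => //; first exact: before_exit_upto_lty.
  by move=> p _; rewrite ger0_norm.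
have iv : m.-integrable D (EFin \o (fun p => phi p.2 (p.1 + 0))).
  apply: (@bounded_integrable _ _ _ m D _ M) => //.
  - exact: before_exit_upto_lty.
  - exact: measurable_funTS.
  - by move=> p _; rewrite ger0_norm; [exact: fM|exact: f0].
have law_lty : (law P z setT < +oo)%E by rewrite law_setT ltry.
have iA u : measurable_fun setT (A u) -> (forall w, `|A u w| <= M * N) ->
    (law P z).-integrable setT (EFin \o A u).
  by move=> mA bA; apply: (@bounded_integrable _ _ _ (law P z) setT _ (M * N)).
transitivity (h^-1%:E * (\int[m]_(p in D) (transition_semigroup P X h f (pt e (process_coord X e p)))%:E
    - \int[m]_(p in D) (phi p.2 (p.1 + 0))%:E))%E.
  rewrite -integralB_EFin// -integralZl//; last exact: integrableB.
  apply: eq_integral => -[t w]; rewrite inE => -[/= t0]; rewrite lt_min => /andP[tT _].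
  have [_ _ XE] := before_exit_coord hX a0 bl t0 tT.
  by rewrite /q /phi addr0 max_r// XE -EFinB -EFinM mulrC.
rewrite integral_semigroup_coord// Ih I0 -integralB_EFin//; [|exact: iA|exact: iA].
rewrite -integralZl//; last by apply: integrableB => //; exact: iA.
Qed.

(** Dominated convergence is about sequences, so the limit at [0] is taken along [n.+1%:R^-1]. *)
Let harmonic_at_right (F : R -> R) (l : R) : F h @[h --> 0^'+] --> l ->
  F n.+1%:R^-1 @[n --> \oo] --> l.
Proof.
move=> /cvg_at_rightP; apply; split => [n|]; last exact: cvg_harmonic.
by rewrite invr_gt0.
Qed.

(** The limit of [increment_integral] as [h] tends to [0]. On the left the generator provides the
    limit [g] and the bound [K]; on the right [average_increment] provides the limit and the bound
    [2 * M]. Taking [f] nonnegative lets Tonelli's theorem and the Markov property apply to it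
    directly; the functions of [green_domain] are made so by adding a constant. *)
Lemma dynkin_formula :
  (\int[m]_(p in D) (g (pt e (process_coord X e p)))%:E =
   \int[law P z]_w (f (X (sig w) w) - f z)%:E)%E.
Proof.
have [_ [cg [Mg gMg]] [K qK] qg] := fg.
have h0 n : 0 < n.+1%:R^-1 :> R by rewrite invr_gt0.
have h1 n : n.+1%:R^-1 <= 1 :> R by rewrite invf_le1// ler1n.
have s0 w : 0 <= sig w by have /andP[] := exit_upto_bounds w.
have mq n : measurable_fun D (fun p => q n.+1%:R^-1 (pt e (process_coord X e p))).
  apply: measurable_funM => //; apply: measurable_funB.
    exact: measurable_semigroup_coord (ltW (h0 n)).
  apply: (@eq_measurable_fun _ _ _ _ D (fun p => phi p.2 (p.1 + 0))).
    move=> [t w]; rewrite inE => -[/= t0]; rewrite lt_min => /andP[tT _].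
    have [_ _ XE] := before_exit_coord hX a0 bl t0 tT.
    by rewrite /phi addr0 max_r// XE.
  by apply: measurable_funTS; exact: measurable_path_function.
have cvq p : q n.+1%:R^-1 (pt e (process_coord X e p)) @[n --> \oo] -->
    g (pt e (process_coord X e p)).
  exact: (harmonic_at_right (qg _)).
have mg : measurable_fun D (fun p => g (pt e (process_coord X e p))).
  by apply: (measurable_fun_cvg mq) => p _; exact: cvq.
have iK (K0 : R) : m.-integrable D (cst K0%:E).
  apply: (@bounded_integrable _ _ _ m D (cst K0) `|K0|) => //.
  exact: before_exit_upto_lty.
have [_ _ cL] := @dominated_convergence _ _ _ m D mD
  (fun n p => (q n.+1%:R^-1 (pt e (process_coord X e p)))%:E)
  (fun p => (g (pt e (process_coord X e p)))%:E) (cst K%:E)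
  (fun n => (measurable_EFinP _ _).2 (mq n)) ((measurable_EFinP _ _).2 mg)
  (aeW m (fun p _ => cvgn_EFin (cvq p)))
  (iK K) (aeW m (fun p n _ => qK _ _ (h0 n))).
have bphi w t : `|phi w t| <= M by rewrite ger0_norm; [exact: fM|exact: f0].
have AIE n w : n.+1%:R^-1^-1 * (A n.+1%:R^-1 w - A 0 w) =
    n.+1%:R^-1^-1 * \int[leb]_(t in `[0, sig w[) (phi w (t + n.+1%:R^-1) - phi w t).
  by rewrite path_function_increment// ltW.
have cA w : n.+1%:R^-1^-1 * (A n.+1%:R^-1 w - A 0 w) @[n --> \oo] -->
    f (X (sig w) w) - f (X 0 w).
  under eq_fun do rewrite AIE.
  have [_] := average_increment (@cphi w) (bphi w) (s0 w).
  by rewrite /phi max_r// maxxx.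
have bA n w : `|n.+1%:R^-1^-1 * (A n.+1%:R^-1 w - A 0 w)| <= 2 * M.
  rewrite AIE; have [+ _] := average_increment (@cphi w) (bphi w) (s0 w).
  exact.
have mAn n : measurable_fun setT (fun w => n.+1%:R^-1^-1 * (A n.+1%:R^-1 w - A 0 w)).
  apply: measurable_funM => //; apply: measurable_funB.
  - by have [] := integral_path_function (ltW (h0 n)).
  - by have [] := integral_path_function (lexx 0).
have mlim : measurable_fun setT (fun w => f (X (sig w) w) - f (X 0 w)).
  by apply: (measurable_fun_cvg mAn) => w _; exact: cA.
have iK' (K0 : R) : (law P z).-integrable setT (cst K0%:E).
  apply: (@bounded_integrable _ _ _ (law P z) setT (cst K0) `|K0|) => //.
  by rewrite -[X in (X < _)%E]/(law P z setT) law_setT ltry.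
have [_ _ cR] := @dominated_convergence _ _ _ (law P z) setT measurableT
  (fun n w => (n.+1%:R^-1^-1 * (A n.+1%:R^-1 w - A 0 w))%:E)
  (fun w => (f (X (sig w) w) - f (X 0 w))%:E) (cst (2 * M)%:E)
  (fun n => (measurable_EFinP _ _).2 (mAn n)) ((measurable_EFinP _ _).2 mlim)
  (aeW (law P z) (fun w _ => cvgn_EFin (cA w)))
  (iK' (2 * M)) (aeW (law P z) (fun w n _ => bA n w)).
transitivity (\int[law P z]_w (f (X (sig w) w) - f (X 0 w))%:E)%E.
  have cL' : (\int[m]_(p in D) (q n.+1%:R^-1 (pt e (process_coord X e p)))%:E)%E @[n --> \oo] -->
      (\int[law P z]_w (f (X (sig w) w) - f (X 0 w))%:E)%E.
    apply: cvg_trans cR; apply: near_eq_cvg; apply: nearW => n.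
    exact/esym/(increment_integral (h0 n)).
  exact: (cvg_unique _ cL cL').
(* The starting point [X 0 w] is [z] for almost every [w] only. *)
apply: ae_eq_integral => //.
- exact/measurable_EFinP.
- apply/measurable_EFinP.
  have -> : (fun w => f (X (sig w) w) - f z) =
      (fun w => (f (X (sig w) w) - f (X 0 w)) + (f (X 0 w) - f z)).
    by apply/funext => w; rewrite subrKA.
  apply: measurable_funD => //; apply: measurable_funB => //.
  apply: (measurableT_comp (borel_continuous cf)); exact: (process_measurable hX).
- exists (~` [set w | X 0 w = z]); split.
  + by apply: measurableC; exact: (measurable_start hX).
  + exact: (law_startC hX).
  + by move=> w /= + Xz; apply; rewrite Xz.
Qed.

End bounded_function.
End dynkin.

(** * Functions in the domain of the operator *)

Lemma continuous_support_bounded (R : realType) (g : R -> R) (l u : R) : l <= u ->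
  continuous g -> (forall y, y \notin `[l, u] -> g y = 0) ->
  exists M, forall y, `|g y| <= M.
Proof.
move=> lu cg g0.
have cg' : {within `[l, u], continuous (fun y => `|g y|)}.
  apply: continuous_subspaceT => y.
  exact: (@continuous_comp _ _ _ g (fun v => `|v|) y (cg y) (@norm_continuous _ R _)).
have [c _ gc] := EVT_max lu cg'.
exists `|g c| => y; have [/gc//|/negP/negP/g0 ->] := boolP (y \in `[l, u]).
by rewrite normr0.
Qed.

Section green_construction.
Context {R : realType} {G : star_graph R} (C : diffusion_coefs G).
Variables (e : edge G) (p a b q : R).
Hypotheses (p0 : 0 < p) (pa : p < a) (ab : a < b) (bq : b < q).
Hypothesis ql : (q%:E < len e)%E.

Let m := speed C e.
Let E : set (measurableTypeR R) := `[p, q]%classic.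
(** The scale is only controlled within the edge. Clamping to [[p, q]] makes [s] continuous and
    nondecreasing on the whole line, and makes the potentials below constant on each side of
    [[p, q]]. *)
Let clamp y : R := Num.max p (Num.min q y).
Let s y : R := scale C e (clamp y).

Let pq : p < q. Proof. exact: lt_trans pa (lt_trans ab bq). Qed.

Let clampE y : p <= y <= q -> clamp y = y.
Proof. by move=> /andP[py yq]; rewrite /clamp min_r// max_r. Qed.

Let clamp_itv y : p <= clamp y <= q.
Proof. by rewrite /clamp le_max lexx/= ge_max ltW//= ge_min lexx. Qed.

Let len_itv y : y <= q -> (y%:E < len e)%E.
Proof. by move=> yq; rewrite (le_lt_trans _ ql)// lee_fin. Qed.

Let sE y : p <= y <= q -> s y = scale C e y.
Proof. by move=> pyq; rewrite /s clampE. Qed.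

Let scale_mono x y : 0 <= x -> x <= y -> y <= q -> scale C e x <= scale C e y.
Proof.
move=> x0; rewrite le_eqVlt => /predU1P[->//|xy] yq.
by apply/ltW; apply: scale_increasing => //; exact: len_itv.
Qed.

Let s_mono x y : x <= y -> s x <= s y.
Proof.
move=> xy; have /andP[h1 _] := clamp_itv x; have /andP[_ h2] := clamp_itv y.
apply: scale_mono => //; first exact: le_trans (ltW p0) h1.
rewrite /clamp ge_max !le_max lexx/=; apply/orP; right.
by rewrite le_min !ge_min lexx xy orbT.
Qed.

Let s_strict x y : p <= x -> x < y -> y <= q -> s x < s y.
Proof.
move=> px xy yq; rewrite !sE; [|by rewrite (le_trans px (ltW xy))|by rewrite px (le_trans (ltW xy))].
by apply: scale_increasing => //; [exact: le_trans (ltW p0) px|exact: len_itv].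
Qed.

Let s_continuous : continuous s.
Proof.
have /subspace_continuousP cs := @Defs.scale_continuous _ _ C e.
move=> y A; have /andP[cp cq] := clamp_itv y.
have /cs sy : [set x | 0 <= x /\ (x%:E < len e)%E] (clamp y).
  by split; [exact: le_trans (ltW p0) cp|exact: len_itv].
move=> /sy wA.
have ccl : continuous clamp.
  move=> u; apply: (@continuous_max R R (cst p) _ u (cvg_cst _)).
  exact: (@continuous_min R R (cst q) id u (cvg_cst _) cvg_id).
apply: (@filterS _ (nbhs y) _ _ _ _ (ccl y _ wA)) => u /=; apply.
have /andP[cp' cq'] := clamp_itv u.
by split; [exact: le_trans (ltW p0) cp'|exact: len_itv].
Qed.

(** A fundamental solution: in [x], inside [[p, q]], its right derivative with respect to the scale
    is the indicator of [y <= x]. Integrated against $g\,dm$ it thus solves $D_m D_s u = g$ with $u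
    = 0$ to the left of [p]. *)
Let K x y : R := Num.max 0 (s x - s y).

Let K_lip x x' y : `|K x y - K x' y| <= `|s x - s x'|.
Proof.
wlog xx : x x' / s x' <= s x.
  move=> H; have [/H//|/ltW/H] := leP (s x') (s x).
  by rewrite distrC [X in _ <= X]distrC.
rewrite !ger0_norm ?subr_ge0//; rewrite /K; last first.
  by rewrite ge_max !le_max lexx/= lerD2r xx orbT.
case: (leP 0 (s x' - s y)) => h1; case: (leP 0 (s x - s y)) => h2; lra.
Qed.

Let mE : measurable E. Proof. exact: measurable_itv. Qed.

Let m_lty (A : set (measurableTypeR R)) : measurable A -> A `<=` E -> (m A < +oo)%E.
Proof.
move=> mA AE; apply: (@le_lt_trans _ _ (m `[0%R, q]%classic)).
  apply: le_measure; rewrite ?inE//.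
  move=> y /AE; rewrite /E /= !in_itv /= => /andP[py yq]; rewrite yq andbT.
  exact: le_trans (ltW p0) py.
by apply: speed_locfin => //; exact: ltW (lt_trans p0 pq).
Qed.

Let mK x : measurable_fun setT (K x).
Proof.
apply: measurable_maxr => //; apply: measurable_funB => //.
exact: (continuous_measurable_fun s_continuous).
Qed.

Let K_bound x y : `|K x y| <= s q - s p.
Proof.
have h v : s p <= s v <= s q.
  have sp : s p = s (clamp p) by rewrite clampE// lexx ltW.
  rewrite /s; have /andP[? ?] := clamp_itv v; rewrite -/(s v).
  have -> : s v = s (clamp v) by rewrite [in RHS]/s clampE.
  by rewrite !s_mono.
have /andP[h1 h2] := h x; have /andP[h3 h4] := h y.
rewrite ger0_norm.
  rewrite /K ge_max subr_ge0; apply/andP; split; first by rewrite s_mono// ltW.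
  exact: lerB.
by rewrite le_max lexx.
Qed.

Section potential.
Variable g : R -> R.
Hypotheses (cg : continuous g) (g0 : forall y, y \notin `[p, q] -> g y = 0).

Let g_bounded : exists M, forall y, `|g y| <= M.
Proof. exact: continuous_support_bounded (ltW pq) cg g0. Qed.

Let mg : measurable_fun setT (g : measurableTypeR R -> R).
Proof. exact: continuous_measurable_fun. Qed.

Lemma potential_integrable (k : R -> R) (B : R) : measurable_fun setT k ->
  (forall y, `|k y| <= B) -> m.-integrable E (EFin \o (fun y => k y * g y)).
Proof.
move=> mk kB; have [M gM] := g_bounded.
apply: (@bounded_integrable _ _ _ m E _ (B * M)) => //.
- exact: m_lty.
- by apply: measurable_funTS; exact: measurable_funM.
- by move=> y _; rewrite normrM ler_pM.
Qed.

Definition potential x : R := \int[m]_(y in E) (K x y * g y).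

Lemma potentialB x x' :
  potential x - potential x' = \int[m]_(y in E) ((K x y - K x' y) * g y).
Proof.
have iK v := potential_integrable (mK v) (K_bound v).
rewrite /potential -RintegralB//.
by apply: eq_Rintegral => y _; rewrite mulrBl.
Qed.

Lemma potential_continuous : continuous potential.
Proof.
have [M gM] := g_bounded.
have M0 : 0 <= M by exact: le_trans (normr_ge0 (g 0)) (gM 0).
(* A Lipschitz constant of the potential with respect to [s]. *)
pose c := M * fine (m E).
have c0 : 0 <= c by rewrite mulr_ge0// fine_ge0.
have lip x x' : `|potential x - potential x'| <= `|s x - s x'| * c.
  rewrite potentialB (le_trans (le_normr_Rintegral _ _))//.
    apply: (@potential_integrable (fun y => K x y - K x' y) `|s x - s x'|).
      exact: measurable_funB (mK x) (mK x').
    by move=> y; exact: K_lip.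
  have -> : `|s x - s x'| * c = \int[m]_(y in E) (cst (`|s x - s x'| * M) y).
    by rewrite Rintegral_cst// mulrA.
  apply: le_Rintegral => //.
  - apply: (@integrable_norm _ _ _ m E (fun y => (K x y - K x' y) * g y)).
    apply: (@potential_integrable (fun y => K x y - K x' y) `|s x - s x'|).
      exact: measurable_funB (mK x) (mK x').
    by move=> y; exact: K_lip.
  - apply: (@bounded_integrable _ _ _ m E (cst _) (Num.norm (`|s x - s x'| * M))) => //.
    exact: m_lty.
  - by move=> y _; rewrite normrM ler_pM.
move=> x; apply/cvgrPdist_lt => eps eps0.
have c1 : 0 < c + 1 by rewrite ltr_wpDl.
have sx : \forall y \near x, `|s x - s y| < eps / (c + 1).
  by have /cvgrPdist_lt := @s_continuous x; apply; rewrite divr_gt0.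
apply: filterS sx => y sxy.
rewrite (le_lt_trans (lip x y))// (@le_lt_trans _ _ (`|s x - s y| * (c + 1)))//.
  by rewrite ler_wpM2l// lerDl.
by rewrite -ltr_pdivlMr.
Qed.

Lemma potential_low x : x <= p -> potential x = 0.
Proof.
move=> xp; rewrite /potential (@eq_Rintegral _ _ _ _ _ (cst 0)) ?Rintegral_cst ?mul0r//.
move=> y; rewrite inE /E/= in_itv/= => /andP[py _].
by rewrite /K max_l ?mul0r// subr_le0 s_mono// (le_trans xp).
Qed.

Lemma potential_high x : q <= x -> potential x = potential q.
Proof.
move=> qx; apply: eq_Rintegral => y _; rewrite /K /s.
by rewrite (_ : clamp x = clamp q)// /clamp minxx min_l.
Qed.

Lemma potential_bounded : exists M, forall x, `|potential x| <= M.
Proof.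
have cp := continuous_subspaceT potential_continuous.
have cg' : {within `[p, q], continuous (fun y => `|potential y|)}.
  apply: continuous_subspaceT => y.
  exact: (@continuous_comp _ _ _ potential (fun v => `|v|) y
    (potential_continuous (x:=y)) (@norm_continuous _ R _)).
have [c _ gc] := EVT_max (ltW pq) cg'.
exists `|potential c| => x; have [xp|px] := leP x p.
  by rewrite potential_low// normr0.
have [qx|xq] := leP q x; last by apply: gc; rewrite in_itv/= !ltW.
by rewrite potential_high//; apply: gc; rewrite in_itv/= lexx ltW.
Qed.

(** The inequality [y <= x] is large because the derivative is taken from the right: an atom of the
    speed measure at [x] already counts, in accordance with the intervals []x, y]] of
    [edge_operator]. *)
Definition potential_slope x : R := \int[m]_(y in E) ((y <= x)%R%:R * g y).

Let mle x : measurable_fun setT (fun y : measurableTypeR R => (y <= x)%R%:R : R).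
Proof.
rewrite (_ : (fun y => _) = \1_(`]-oo, x]%classic)); first exact: measurable_indic.
by apply/funext => y; rewrite indicE; congr (nat_of_bool _)%:R;
  apply/idP/idP; rewrite inE/= in_itv.
Qed.

Lemma potential_slopeB x y : x < y ->
  potential_slope y - potential_slope x = \int[m]_(z in `]x, y]) g z.
Proof.
move=> xy; have b1 (v z : R) : `|(z <= v)%R%:R : R| <= 1 by case: (z <= v); rewrite ?normr1 ?normr0.
have iS v := potential_integrable (mle v) (b1 v).
rewrite /potential_slope -RintegralB//.
rewrite [LHS]Rintegral_mkcond [RHS]Rintegral_mkcond; apply: eq_Rintegral => z _.
rewrite !patchE; case: ifPn => [_|zE]; last first.
  by rewrite g0 ?if_same//; apply: contra zE; rewrite inE.
have -> : (z \in (`]x, y]%classic : set (measurableTypeR R))) = (x < z <= y).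
  by apply/idP/idP; rewrite inE/= in_itv.
have [zx|xz] := leP z x; first by rewrite (le_trans zx (ltW xy)) subrr.
by case: (z <= y); rewrite mul0r subr0 ?mul1r ?mul0r.
Qed.

Hypothesis J0 : \int[m]_(y in E) g y = 0.

(** Below [p] both sides vanish. From [q] on the potential is constant while the slope is the whole
    mass of [g], whence [J0]. In between, the difference quotients of [K] have absolute value at
    most 1 and are eventually equal to the indicator of [y <= x], so dominated convergence
    applies. *)
Lemma potential_derive x : 0 < x -> (x%:E < len e)%E ->
  (potential u - potential x) / (scale C e u - scale C e x) @[u --> x^'+] -->
  potential_slope x.
Proof.
move=> x0 xl.
have [xp|px] := ltP x p.
  have -> : potential_slope x = 0.
    rewrite /potential_slope (@eq_Rintegral _ _ _ _ _ (cst 0)) ?Rintegral_cst ?mul0r//.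
    move=> y; rewrite inE /E/= in_itv/= => /andP[py _].
    by rewrite leNgt (lt_le_trans xp py) mul0r.
  apply: cvg_near_cst; near=> u.
  by rewrite !potential_low ?subrr ?mul0r// ltW//; near: u; exact: nbhs_right_lt.
have [qx|xq] := leP q x.
  have -> : potential_slope x = 0.
    rewrite -[RHS]J0; apply: eq_Rintegral => y; rewrite inE /E/= in_itv/= => /andP[_ yq].
    by rewrite (le_trans yq qx) mul1r.
  apply: cvg_near_cst; near=> u.
  have xu : x < u by near: u; exact: nbhs_right_gt.
  by rewrite !potential_high ?subrr ?mul0r// (le_trans qx (ltW xu)).
apply/cvg_at_rightP => u [xu ux].
have [M gM] := g_bounded.
have sx n : u n <= q -> 0 < s (u n) - s x by move=> uq; rewrite subr_gt0 s_strict.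
(* [s] increases strictly on [[p, q]] only, hence the value [0] for the finitely many [u n] beyond
   [q]. *)
pose F n (y : measurableTypeR R) : R :=
  if u n <= q then (K (u n) y - K x y) / (s (u n) - s x) * g y else 0.
have F_le n y : `|F n y| <= M.
  rewrite /F; case: ifPn => uq; last by rewrite normr0 (le_trans _ (gM 0)).
  rewrite normrM (le_trans _ (gM y))// ler_piMl// normrM normfV.
  rewrite ler_pdivrMr ?normr_gt0 ?gt_eqF ?sx// mul1r; exact: K_lip.
have mF n : measurable_fun E (F n).
  apply: measurable_funTS; rewrite /F; case: (u n <= q) => //.
  apply: measurable_funM => //; apply: measurable_funM => //.
  exact: measurable_funB (mK _) (mK _).
have cF y : F n y @[n --> \oo] --> (y <= x)%R%:R * g y.
  have uq : \forall n \near \oo, u n <= q.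
    by have /cvgr_le := ux; apply.
  have [yx|xy] := leP y x.
    apply: cvg_near_cst; apply: filterS uq => n uq; rewrite /F uq mul1r.
    rewrite /K !max_r ?subr_ge0 ?s_mono//; last by rewrite (le_trans yx)// ltW.
    by rewrite opprB addrA subrK mulfV ?mul1r// gt_eqF// sx.
  have uy : \forall n \near \oo, u n <= y by have /cvgr_le := ux; apply.
  rewrite mul0r; apply: cvg_near_cst; apply: filterS2 uq uy => n uq uy.
  by rewrite /F uq /K !max_l ?subrr ?mul0r// subr_le0 s_mono// ltW.
have [_ _ cv] := @dominated_convergence _ _ _ m E mE (fun n y => (F n y)%:E)
  (fun y => ((y <= x)%R%:R * g y)%:E) (cst M%:E)
  (fun n => (measurable_EFinP _ _).2 (mF n))
  ((measurable_EFinP _ _).2 (measurable_funTS (measurable_funM (mle x) mg)))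
  (aeW m (fun y _ => cvgn_EFin (cF y)))
  (@bounded_integrable _ _ _ m E (cst M) `|M| mE (m_lty mE (@subset_refl _ _))
    (measurable_cst _) (fun _ _ => lexx _))
  (aeW m (fun y n _ => F_le n y)).
have : \int[m]_(y in E) F n y @[n --> \oo] --> potential_slope x.
  apply: fine_cvg; rewrite fineK; first exact: cv.
  apply: integrable_fin_num => //.
  apply: (@potential_integrable _ 1 (mle x)) => y.
  by case: (y <= x); rewrite ?normr1 ?normr0.
apply: cvg_trans; apply: near_eq_cvg.
have uq : \forall n \near \oo, u n <= q by have /cvgr_le := ux; apply.
apply: filterS uq => n uq; rewrite potentialB.
rewrite -!sE ?px ?uq ?(ltW xq)//; last by rewrite (le_trans px)// ltW.
rewrite mulrC -RintegralZl//; last first.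
  apply: (@potential_integrable (fun y => K (u n) y - K x y) `|s (u n) - s x|).
    exact: measurable_funB (mK _) (mK _).
  by move=> y; exact: K_lip.
by apply: eq_Rintegral => y _; rewrite /F uq mulrA [_^-1 * _]mulrC.
Unshelve. all: by end_near. Qed.

(** Near the central vertex and on the other edges the function is constant and [g] vanishes, so
    both sides of the vertex condition are zero. The constant [c] is there to make the function
    nonnegative. *)
Lemma potential_operator (c : R) : diffusion_operator C
  (fun z => potential (edge_coord e z) + c) (fun z => g (edge_coord e z)).
Proof.
have g00 : g 0 = 0 by apply: g0; rewrite in_itv/= leNgt p0.
have cpot : continuous (fun z => potential (edge_coord e z) + c).
  have cpc : continuous (fun v => potential v + c).
    by move=> v; apply: cvgD; [exact: potential_continuous|exact: cvg_cst].
  move=> z; apply: (@cvg_comp _ _ _ (edge_coord e) (fun v => potential v + c) _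
    (nbhs (edge_coord e z))); last exact: cpc.
  exact: continuous_edge_coord.
split.
- split=> //; have [M potM] := potential_bounded; exists (M + `|c|) => z.
  by rewrite (le_trans (ler_normD _ _))// lerD2r.
- split; last by have [M gM] := g_bounded; exists M.
  move=> z; apply: (@cvg_comp _ _ _ (edge_coord e) g _ (nbhs (edge_coord e z))).
    exact: continuous_edge_coord.
  exact: cg.
- move=> e'; have [->|ee'] := eqVneq e' e.
  + exists potential_slope; split=> [x x0 xl|x y x0 xy yl].
      apply: cvg_trans (potential_derive x0 xl); apply: near_eq_cvg.
      have ul : \forall u \near x^'+, (u%:E < len e)%E.
        case: (len e) xl => [r||//] xr; last by apply: nearW => u; rewrite ltry.
        by near=> u; rewrite lte_fin; near: u; apply: nbhs_right_lt; rewrite -lte_fin.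
      have ux := @nbhs_right_gt R x.
      apply: filterS2 ul ux => u ul xu.
      rewrite !edge_coord_pt ?(ltW x0)//; last exact: ltW (lt_trans x0 xu).
      by rewrite opprD addrACA subrr addr0.
    rewrite potential_slopeB//; apply: eq_Rintegral => z; rewrite inE/= in_itv/=.
    move=> /andP[xz zy]; rewrite edge_coord_pt//; first exact: ltW (lt_trans x0 xz).
    by rewrite (le_lt_trans _ yl)// lee_fin.
  + exists (cst 0); split=> [x _ _|x y _ _ _].
      under eq_fun do rewrite !edge_coord_pt_neq// subrr mul0r.
      exact: cvg_cst.
    rewrite subrr (@eq_Rintegral _ _ _ _ _ (cst 0)) ?Rintegral_cst ?mul0r//.
    by move=> z _; rewrite edge_coord_pt_neq.
- exists (fun=> 0); split=> [e'|]; last first.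
    rewrite big1 => [|e' _]; last by rewrite mulr0.
    rewrite /central_vertex; have [<-|ne] := eqVneq ord0 e.
      by rewrite edge_coord_pt// ?g00 ?mulr0// len_gt0.
    by rewrite edge_coord_pt_neq// g00 mulr0.
  apply: cvg_near_cst; have [->|ee'] := eqVneq e' e; last first.
    by apply: nearW => u; rewrite !edge_coord_pt_neq// subrr mul0r.
  near=> u.
  have u0 : 0 < u by near: u; exact: nbhs_right_gt.
  have up : u < p by near: u; exact: nbhs_right_lt.
  rewrite !edge_coord_pt ?len_gt0 ?(ltW u0)//; last first.
    by rewrite len_itv// (le_trans (ltW up))// ltW.
  by rewrite !potential_low ?subrr ?mul0r// ltW.
Unshelve. all: by end_near. Qed.

End potential.


Section potential_green.
Variable g : R -> R.
Hypotheses (cg : continuous g) (g0 : forall y, y \notin `[p, q] -> g y = 0).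

Let sa : s a = scale C e a. Proof. by rewrite sE// !ltW// (lt_trans ab). Qed.
Let sb : s b = scale C e b. Proof. by rewrite sE// !ltW// (lt_trans pa). Qed.
Let sab : 0 < s b - s a. Proof. by rewrite subr_gt0 s_strict// ltW. Qed.

Let KB_bound x x' y : `|K x y - K x' y| <= `|s x - s x'|. Proof. exact: K_lip. Qed.

(** Subtracting from the potential its affine interpolation in the scale between [a] and [b] changes
    the kernel [K] into the Green kernel, up to the sign. *)
Lemma potential_green x : a <= x <= b ->
  potential g b = potential g a ->
  potential g a - potential g x = \int[m]_(y in `]a, b[) (green C e a b x y * g y).
Proof.
move=> /andP[ax xb] gab.
have sx : s x = scale C e x by rewrite sE// (le_trans (ltW pa) ax) (le_trans xb)// ltW.
pose l := (s x - s a) / (s b - s a).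
have i1 : m.-integrable E (EFin \o (fun y => (K b y - K a y) * g y)).
  by apply: (potential_integrable cg g0 _ (KB_bound b a)); exact: measurable_funB (mK _) (mK _).
have i2 : m.-integrable E (EFin \o (fun y => (K a y - K x y) * g y)).
  by apply: (potential_integrable cg g0 _ (KB_bound a x)); exact: measurable_funB (mK _) (mK _).
have i3 : m.-integrable E (EFin \o (fun y => l * ((K b y - K a y) * g y))).
  exact: (integrableZl mE l i1).
(* The added term is zero by [gab]. The combined kernel [l * (K b y - K a y) + (K a y - K x y)]
   vanishes for [y <= a] and for [b <= y], and is [green] in between, which is checked case by
   case. *)
transitivity (l * (potential g b - potential g a) + (potential g a - potential g x)).
  by rewrite gab subrr mulr0 add0r.
rewrite !potentialB// -RintegralZl// -RintegralD//.
rewrite [LHS]Rintegral_mkcond [RHS]Rintegral_mkcond; apply: eq_Rintegral => y _.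
rewrite !patchE.
have -> : (y \in E) = (p <= y <= q) by apply/idP/idP; rewrite inE /E/= in_itv.
have -> : (y \in (`]a, b[%classic : set (measurableTypeR R))) = (a < y < b).
  by apply/idP/idP; rewrite inE/= in_itv.
have [py|yp] := leP p y; last first.
  by rewrite /= ifF//; apply/negP => /andP[ay _]; move: (lt_trans yp pa); rewrite ltNge ltW.
have [yq|qy] := leP y q; last first.
  by rewrite /= ifF//; apply/negP => /andP[_ yb]; move: (lt_trans bq qy); rewrite ltNge ltW.
rewrite /= /K.
have [ya|ay] := leP y a.
  rewrite !max_r ?subr_ge0 ?s_mono//; [|exact: le_trans ya _|exact: le_trans ya (ltW ab)].
  have lE : l * (s b - s a) = s x - s a by rewrite /l mulfVK ?gt_eqF.
  rewrite /= mulrA (_ : s b - s y - (s a - s y) = s b - s a) ?lE; last by ring.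
  by rewrite -[RHS]/(0 : R); ring.
have [by_|yb] := leP b y.
  rewrite !max_l ?subr_le0 ?s_mono// ?(ltW ay)//; last exact: le_trans xb _.
  by rewrite !subrr mul0r mulr0 addr0.
rewrite /=.
have syE : s y = scale C e y by rewrite sE// py.
rewrite mulrA -mulrDl; congr (_ * _).
rewrite /green -sa -sb.
rewrite [Num.max 0 (s b - s y)]max_r ?subr_ge0 ?s_mono ?(ltW yb)//.
rewrite [Num.max 0 (s a - s y)]max_l ?subr_le0 ?s_mono ?(ltW ay)// subr0 sub0r.
have sab0 : s b - s a != 0 by rewrite gt_eqF.
have [xy|yx] := leP x y.
  rewrite max_l ?subr_le0 ?s_mono// oppr0 addr0.
  by rewrite -sx -syE /l mulrAC.
rewrite max_r ?subr_ge0 ?s_mono ?(ltW yx)//.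
rewrite -sx -syE /l.
by field.
Qed.

End potential_green.

Let bump (l r y : R) : R := Num.max 0 ((y - l) * (r - y)).

Let bump_continuous l r : continuous (bump l r).
Proof.
move=> u; apply: (@continuous_max R R (cst 0) _ u (cvg_cst _)).
by apply: cvgM; apply: cvgB; [exact: cvg_id|exact: cvg_cst|exact: cvg_cst|exact: cvg_id].
Qed.

Let bump0 l r y : l < r -> y \notin `[l, r] -> bump l r y = 0.
Proof.
move=> lr; rewrite in_itv/= negb_and -!ltNge => /orP[yl|ry]; rewrite /bump max_l//.
  by rewrite mulr_le0_ge0// ?subr_le0 ?subr_ge0 ltW// (lt_trans yl).
by rewrite mulr_ge0_le0// ?subr_le0 ?subr_ge0 ltW// (lt_trans lr).
Qed.

Let bump_integral_gt0 l r : p <= l -> l < r -> r <= q ->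
  0 < \int[m]_(y in E) bump l r y.
Proof.
move=> pl lr rq.
(* With a quarter of the length, the middle interval []l + dl, r - dl[] is nonempty, hence charged
   by the speed measure, and both factors of the bump are at least [dl] on it. *)
pose dl := (r - l) / 4; have dl0 : 0 < dl by rewrite divr_gt0// subr_gt0.
have dlE : dl * 4 = r - l by rewrite /dl mulfVK.
pose A : set (measurableTypeR R) := `]l + dl, r - dl[%classic.
have mA : measurable A by exact: measurable_itv.
have AE : A `<=` E.
  move=> y; rewrite /A /E /= !in_itv/= => /andP[h1 h2].
  by apply/andP; split; lra.
have mA0 : (0 < m A)%E.
  have h1 : 0 <= l + dl by rewrite addr_ge0// ?(ltW dl0)// (le_trans (ltW p0) pl).
  have h2 : l + dl < r - dl by lra.
  have h3 : ((r - dl)%:E < len e)%E by apply: len_itv; lra.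
  exact: (Defs.speed_gt0 C h1 h2 h3).
have bz y : y \notin `[p, q] -> bump l r y = 0.
  move=> yn; apply: bump0 => //; apply: contra yn; rewrite !in_itv/= => /andP[h1 h2].
  by rewrite (le_trans pl h1) (le_trans h2 rq).
have ib : m.-integrable E (EFin \o bump l r).
  have := potential_integrable (@bump_continuous l r) bz (k := cst 1) (B := 1).
  under [X in _ -> _ -> _.-integrable _ X]eq_fun do rewrite /= mul1r.
  by apply => // y; rewrite normr1.
have iA : m.-integrable E (EFin \o (fun y => dl ^+ 2 * \1_A y)).
  apply: (@bounded_integrable _ _ _ m E _ (dl ^+ 2)) => //.
  - exact: m_lty.
  - apply: measurable_funTS; apply: measurable_funM => //; exact: measurable_indic.
  - move=> y _; rewrite normrM ger0_norm ?sqr_ge0// ler_piMr ?sqr_ge0//.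
    by rewrite indicE; case: (_ \in _); rewrite ?normr1 ?normr0.
apply: (@lt_le_trans _ _ (\int[m]_(y in E) (dl ^+ 2 * \1_A y))).
  rewrite /Rintegral; under eq_integral do rewrite EFinM.
  rewrite ge0_integralZl_EFin ?sqr_ge0//; last first.
    by apply/measurable_EFinP; apply: measurable_funTS; exact: measurable_indic.
  rewrite integral_indic// setIidl// fineM//; last first.
    by rewrite ge0_fin_numE// m_lty.
  by rewrite mulr_gt0 ?exprn_gt0// fine_gt0// mA0 m_lty.
apply: le_Rintegral => // y _; rewrite indicE.
case: (boolP (y \in A)) => [|_]; last by rewrite mulr0 /bump le_max lexx.
rewrite inE /A/= in_itv/= => /andP[h1 h2]; rewrite mulr1 /bump le_max; apply/orP; right.
by rewrite expr2 ler_pM// ?(ltW dl0)//; lra.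
Qed.

(** The correction of [h] is by bumps that vanish on [[a, b]], so the equation inside the segment is
    the prescribed one. *)
Lemma green_domain (h : R -> R) : continuous h ->
  (forall y, y \notin `[a, b] -> h y = 0) ->
  exists f g : star G -> R, [/\ diffusion_operator C f g, (forall z, 0 <= f z),
    f (pt e b) = f (pt e a) &
    forall x, a <= x <= b -> g (pt e x) = h x /\
      f (pt e a) - f (pt e x) = \int[m]_(y in `]a, b[) (green C e a b x y * h y)].
Proof.
move=> ch h0.
have aq : a < q by exact: lt_trans bq.
have pb : p < b by exact: lt_trans ab.
have hz y : y \notin `[p, q] -> h y = 0.
  move=> yn; apply: h0; apply: contra yn; rewrite !in_itv/= => /andP[h1 h2].
  by rewrite (le_trans (ltW pa) h1) (le_trans h2 (ltW bq)).
have b1z y : y \notin `[p, q] -> bump p a y = 0.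
  move=> yn; apply: bump0 => //; apply: contra yn; rewrite !in_itv/= => /andP[-> h2].
  exact: le_trans h2 (ltW aq).
have b2z y : y \notin `[p, q] -> bump b q y = 0.
  move=> yn; apply: bump0 => //; apply: contra yn; rewrite !in_itv/= => /andP[h1 ->].
  by rewrite (le_trans (ltW pb) h1).
pose I (k u : R -> R) := \int[m]_(y in E) (k y * u y).
pose Kab y := K b y - K a y.
(* The system is triangular. [Kab] is zero beyond [b], so the right bump does not affect
   [potential g b - potential g a], and it is the constant [s b - s a] up to [a]; this determines
   [c1]. Then [c2] cancels the total mass. *)
pose c1 := - I Kab h / ((s b - s a) * I (cst 1) (bump p a)).
pose c2 := - (I (cst 1) h + c1 * I (cst 1) (bump p a)) / I (cst 1) (bump b q).
pose g y := h y + c1 * bump p a y + c2 * bump b q y.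
have cg : continuous g.
  move=> y; apply: cvgD; first apply: cvgD; first exact: ch.
    by apply: cvgM; [exact: cvg_cst|exact: bump_continuous].
  by apply: cvgM; [exact: cvg_cst|exact: bump_continuous].
have gz y : y \notin `[p, q] -> g y = 0.
  by move=> yn; rewrite /g hz// b1z// b2z// !mulr0 !addr0.
have lin k (B : R) : measurable_fun setT (k : measurableTypeR R -> R) -> (forall y, `|k y| <= B) ->
    I k g = I k h + c1 * I k (bump p a) + c2 * I k (bump b q).
  move=> mk kB.
  have ih := potential_integrable ch hz mk kB.
  have i1 := potential_integrable (@bump_continuous p a) b1z mk kB.
  have i2 := potential_integrable (@bump_continuous b q) b2z mk kB.
  have j1 : m.-integrable E (EFin \o (fun y => c1 * (k y * bump p a y))) by exact: (integrableZl mE c1 i1).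
  have j2 : m.-integrable E (EFin \o (fun y => c2 * (k y * bump b q y))) by exact: (integrableZl mE c2 i2).
  have j3 : m.-integrable E (EFin \o (fun y => k y * h y + c1 * (k y * bump p a y))) by exact: (integrableD mE ih j1).
  rewrite /I -!RintegralZl// -RintegralD// -RintegralD//.
  by apply: eq_Rintegral => y _; rewrite /g; ring.
have I1E u : I (cst 1) u = \int[m]_(y in E) u y.
  by apply: eq_Rintegral => y _; rewrite mul1r.
have J1 : 0 < I (cst 1) (bump p a) by rewrite I1E bump_integral_gt0// ltW.
have J2 : 0 < I (cst 1) (bump b q) by rewrite I1E bump_integral_gt0// ltW.
have sab : 0 < s b - s a by rewrite subr_gt0 s_strict// ltW.
have K1 : I Kab (bump p a) = (s b - s a) * I (cst 1) (bump p a).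
  have i1 := potential_integrable (@bump_continuous p a) b1z (k := cst 1) (B := 1)
    (measurable_cst _) (fun=> eq_ind_r (fun u => u <= 1) (lexx 1) (normr1 R)).
  rewrite /I -RintegralZl//; apply: eq_Rintegral => y _.
  have [ya|ay] := leP y a; last by rewrite bump0 ?in_itv/= ?leNgt ?ay ?andbF// !mulr0.
  rewrite /Kab /K !max_r ?subr_ge0 ?s_mono//; last exact: le_trans ya (ltW ab).
  by rewrite mul1r; congr (_ * _); ring.
have K2 : I Kab (bump b q) = 0.
  rewrite /I (@eq_Rintegral _ _ _ _ _ (cst 0)) ?Rintegral_cst ?mul0r// => y _.
  have [yb|by_] := ltP y b; first by rewrite bump0 ?in_itv/= ?leNgt ?yb// mulr0.
  by rewrite /Kab /K !max_l ?subrr ?mul0r// subr_le0 s_mono// (le_trans (ltW ab)).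
have Jg : \int[m]_(y in E) g y = 0.
  rewrite -I1E (lin _ 1)//; last by move=> y; rewrite normr1.
  by rewrite /c2 mulfVK ?gt_eqF// subrr.
have gab : potential g b = potential g a.
  apply/eqP; rewrite -subr_eq0 (potentialB cg gz) -/Kab -/(I Kab g).
  rewrite (lin _ `|s b - s a|); last 2 first.
  - exact: measurable_funB (mK _) (mK _).
  - by move=> y; exact: K_lip.
  rewrite K2 mulr0 addr0 K1 /c1 mulfVK ?subrr//.
  by rewrite mulf_neq0// gt_eqF.
have gh y : a <= y <= b -> g y = h y.
  move=> /andP[ay yb]; rewrite /g /bump !max_l ?mulr0 ?addr0//.
    by rewrite mulr_le0_ge0// ?subr_le0// subr_ge0 (le_trans yb)// ltW.
  by rewrite mulr_ge0_le0// ?subr_le0// subr_ge0 (le_trans (ltW pa)).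
have [M gM] := potential_bounded cg gz.
have ptE x : a <= x <= b -> edge_coord e (pt e x) = x.
  move=> /andP[ax xb]; rewrite edge_coord_pt//.
    by rewrite (le_trans _ ax)// ltW// (lt_trans p0).
  by apply: len_itv; rewrite (le_trans xb)// ltW.
exists (fun z => potential g (edge_coord e z) + M), (fun z => g (edge_coord e z)); split.
- exact: potential_operator.
- by move=> z; rewrite -lerBlDr sub0r; have := gM (edge_coord e z); rewrite ler_norml => /andP[].
- by rewrite !ptE ?gab// lexx ltW.
- move=> x xab; rewrite !ptE ?gh// ?lexx ?(ltW ab)//; split => //.
  rewrite opprD addrACA subrr addr0 (potential_green cg gz xab gab).
  apply: eq_Rintegral => y; rewrite inE/= in_itv/= => /andP[ay yb].
  by rewrite gh// !ltW.
Qed.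

End green_construction.

(** * The Green kernel as an occupation density *)

Section green_occupation.
Context {R : realType} {G : star_graph R} {C : diffusion_coefs G}.
Context {d : measure_display} {Om : measurableType d}.
Variables (P : R.-pker (borel_star G) ~> Om) (X : R -> Om -> star G).
Hypothesis hX : general_diffusion P X C.
Variables (e : edge G) (a b x : R).
Hypotheses (a0 : 0 < a) (bl : (b%:E < len e)%E) (ax : a < x) (xb : x < b).

Let ab : a < b. Proof. exact: lt_trans xb. Qed.
Let I : set (measurableTypeR R) := `]a, b[%classic.
Let mI : measurable I. Proof. exact: measurable_itv. Qed.
Let sp := speed C e.
Let s := scale C e.
Let z := pt e x.
Let m := (@lebesgue_measure R \x law P z)%E.
Let T := exit_of X e a b.
Let coord := process_coord X e.

Let s_mono u v : a <= u -> u <= v -> v <= b -> s u <= s v.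
Proof.
move=> au; rewrite le_eqVlt => /predU1P[->//|uv vb].
apply/ltW/Defs.scale_increasing => //; first exact: le_trans (ltW a0) au.
by rewrite (le_lt_trans _ bl)// lee_fin.
Qed.

Let sab : 0 < s b - s a.
Proof. by rewrite subr_gt0; apply: Defs.scale_increasing => //; exact: ltW. Qed.

Let green_factors v y : a <= v <= b -> a <= y <= b ->
  0 <= s (Num.min v y) - s a <= s b - s a /\ 0 <= s b - s (Num.max v y) <= s b - s a.
Proof.
move=> /andP[av vb] /andP[ay yb]; split.
  by rewrite subr_ge0 lerD2r !s_mono// ?le_min ?av// ge_min ?vb.
by rewrite subr_ge0 lerD2l lerN2 !s_mono// ?ge_max ?vb// le_max ?av.
Qed.

Lemma green_ge0 v y : a <= v <= b -> a <= y <= b -> 0 <= green C e a b v y.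
Proof.
move=> vab yab; have [/andP[h1 _] /andP[h2 _]] := green_factors vab yab.
by rewrite /green mulr_ge0 ?invr_ge0 ?(ltW sab)// mulr_ge0.
Qed.

Let green_le v y : a <= v <= b -> a <= y <= b -> green C e a b v y <= s b - s a.
Proof.
move=> vab yab; have [/andP[h1 h1'] /andP[h2 h2']] := green_factors vab yab.
by rewrite /green ler_pdivrMr//; exact: ler_pM.
Qed.

Let xab : a <= x <= b. Proof. by rewrite !ltW. Qed.

Let I_itv y : I y -> a <= y <= b.
Proof. by rewrite /I/= in_itv/= => /andP[? ?]; rewrite !ltW. Qed.

Let measurable_green : measurable_fun I (green C e a b x).
Proof.
have smin : measurable_fun I (fun y => s (Num.min x y)).
  (* Capping [y] at [a] changes nothing on [I] and gives a nondecreasing function on the whole line,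
     in which [s] is only evaluated on [[a, b]]. *)
  apply: (@eq_measurable_fun _ _ _ _ I (fun y => s (Num.min x (Num.max a y)))).
    by move=> y; rewrite inE => /I_itv/andP[ay _]; rewrite (max_r ay).
  apply: nondecreasing_measurable => // u v uv.
  apply: s_mono.
  - by rewrite le_min (ltW ax) le_max lexx.
  - by rewrite le_min !ge_min lexx/= ge_max !le_max lexx uv !orbT.
  - by rewrite ge_min (ltW xb).
have smax : measurable_fun I (fun y => s (Num.max x y)).
  apply: (@eq_measurable_fun _ _ _ _ I (fun y => s (Num.max x (Num.min b y)))).
    by move=> y; rewrite inE => /I_itv/andP[_ yb]; rewrite (min_r yb).
  apply: nondecreasing_measurable => // u v uv.
  apply: s_mono.
  - by rewrite le_max (ltW ax).
  - by rewrite ge_max !le_max lexx/= le_min !ge_min lexx uv !orbT.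
  - by rewrite ge_max (ltW xb) ge_min lexx.
by apply: measurable_funM => //; apply: measurable_funM; apply: measurable_funB.
Qed.

Let sp_lty : (sp I < +oo)%E.
Proof.
apply: (@le_lt_trans _ _ (sp `[0%R, b]%classic)).
  apply: le_measure; rewrite ?inE//.
  move=> y /I_itv/andP[ay yb]; rewrite /= in_itv/= yb andbT.
  exact: le_trans (ltW a0) ay.
by apply: Defs.speed_locfin => //; exact: ltW (lt_trans a0 ab).
Qed.

Let green_integrable (h : R -> R) : measurable_fun I h -> (forall y, 0 <= h y <= 1) ->
  sp.-integrable I (EFin \o (fun y => green C e a b x y * h y)).
Proof.
move=> mh h01.
have mgh : measurable_fun I (fun y => green C e a b x y * h y).
  exact: (measurable_funM measurable_green mh).
apply: (bounded_integrable mI sp_lty mgh (K := s b - s a)) => y /I_itv yab.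
have /andP[h0 h1] := h01 y; have g0 := green_ge0 xab yab.
rewrite ger0_norm; last exact: mulr_ge0.
by rewrite (le_trans _ (green_le xab yab))// ler_piMr.
Qed.

(** A path started inside the segment has a positive exit time, so its position at that time is a
    limit of points of the segment; it lies in [[a, b]] but not in []a, b[]. *)
Let exit_endpoint w t : X 0 w = z -> T w = t%:E -> X t w = pt e a \/ X t w = pt e b.
Proof.
move=> Xz Tt; have cw := cont_path_process hX (w := w).
have [t0 Ut before_t] := (path_exitP (open_seg a0 bl) t cw).1 Tt.
have Uz : seg e a b%:E z.
  by apply/(seg_coord a0 bl); rewrite edge_coord_pt ?ax//; [exact: ltW (lt_trans a0 ax)|
    rewrite (lt_trans _ bl)// lte_fin].
have tpos : 0 < t.
  by rewrite lt_neqAle t0 andbT; apply/eqP => t0'; apply: Ut; rewrite -t0' Xz.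
have cpsi : continuous (fun u : R => edge_coord e (X (Num.max 0 u) w)).
  move=> u; apply: (@cvg_comp _ _ _ (fun u : R => X (Num.max 0 u) w) (edge_coord e) _
    (nbhs (X (Num.max 0 u) w))); last exact: continuous_edge_coord.
  exact: (cont_path_process hX (w := w)).
have tab : a <= edge_coord e (X t w) <= b.
  apply/negPn/negP => ntab.
  have : \forall u \near t, (~` `[a, b]%classic) (edge_coord e (X (Num.max 0 u) w)).
    apply: (cpsi t); apply: open_nbhs_nbhs; split.
      by apply: closed_openC; exact: interval_closed.
    by rewrite max_r//= in_itv/=; exact/negP.
  move=> /nbhs_ballP[r /= r0 rP].
  (* [t - dl] is a nonnegative time before [t], close enough to [t] for the path to be outside
     [[a, b]], whereas it is still in the segment. *)
  pose dl := Num.min r t / 2.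
  have mrt : 0 < Num.min r t by rewrite lt_min r0.
  have dl0 : 0 < dl by rewrite divr_gt0.
  have dlr : dl < Num.min r t by rewrite ltr_pdivrMr// ltr_pMr// ltr1n.
  move: dlr; rewrite lt_min => /andP[dlr dlt].
  have /rP : ball t r (t - dl).
    by rewrite /ball/= opprB addrC subrK gtr0_norm.
  have tdl : 0 <= t - dl by rewrite subr_ge0 ltW.
  rewrite /= max_r//; apply; rewrite in_itv/=.
  have /(seg_coord a0 bl)/andP[h1 h2] : seg e a b%:E (X (t - dl) w).
    by apply: before_t; rewrite tdl gtrBl.
  by rewrite !ltW.
have /andP[h1 h2] := tab.
have cpos : 0 < edge_coord e (X t w) by exact: lt_le_trans h1.
have [XE _] := pt_edge_coord cpos.
have [Ea|na] := eqVneq (edge_coord e (X t w)) a; first by left; rewrite -{1}XE Ea.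
right; rewrite -{1}XE; congr (pt e _); apply/eqP; rewrite eq_le h2 leNgt.
apply/negP => wb; apply: Ut; apply/(seg_coord a0 bl).
by rewrite wb andbT lt_neqAle eq_sym na.
Qed.

Let Z0 := [set w | X 0 w = z].

Let lawZ0 : law P z Z0 = 1%E. Proof. exact: (process_start hX z). Qed.

Let mZ : measurable Z0. Proof. exact: (measurable_start hX). Qed.

Let lawZ0C : law P z (~` Z0) = 0%E. Proof. exact: (law_startC hX). Qed.

Let mT : measurable_fun setT T. Proof. exact: (measurable_exit_of hX a0 bl). Qed.

Let late (N : R) := [set w | (N%:E < T w)%E].

Let mlate N : measurable (late N).
Proof. by rewrite -[X in measurable X]setTI; exact: emeasurable_fun_o_infty. Qed.

(** Dynkin's formula at the truncated exit time, for the [f] given by [green_domain], whose value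
    [f (pt e a)] is the bound [M]. It is essential that [M] depends on [h] but not on [N]. *)
Lemma occupation_bounds (h : R -> R) : continuous h ->
  (forall y, 0 <= h y <= 1) -> (forall y, y \notin `[a, b] -> h y = 0) ->
  exists2 M : R, 0 <= M & forall N, 0 <= N ->
    (\int[m]_(p in before (exit_upto X e a b N)) (h (coord p))%:E <=
      \int[sp]_(y in I) (green C e a b x y * h y)%:E)%E /\
    (\int[sp]_(y in I) (green C e a b x y * h y)%:E <=
      \int[m]_(p in before (exit_upto X e a b N)) (h (coord p))%:E
        + M%:E * law P z (late N))%E.
Proof.
move=> ch h01 h0.
have mh : measurable_fun I h by apply: measurable_funTS; exact: continuous_measurable_fun.
(* Room for the bumps: [q] lies between [b] and the end of the edge, which may be infinite, and
   [a / 2] lies on the other side. *)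
have [q bq ql] : exists2 q, b < q & (q%:E < len e)%E.
  case: (len e) bl => [r||//]; last first.
    by exists (b + 1); [rewrite ltrDl|rewrite ltry].
  rewrite lte_fin => br; exists ((b + r) / 2); rewrite ?lte_fin; lra.
have p0 : 0 < a / 2 by rewrite divr_gt0.
have pa : a / 2 < a by rewrite ltr_pdivrMr// ltr_pMr// ltr1n.
have [f [g [Lfg f0 fab fg]]] := green_domain C p0 pa ab bq ql ch h0.
have gen : infinitesimal_generator P X f g by apply/(process_generator hX).
have [[cf [Mf fM']] _ _ _] := gen.
have fM y : f y <= Mf by rewrite (le_trans (ler_norm _)).
pose J := \int[sp]_(y in I) (green C e a b x y * h y).
have JE : (\int[sp]_(y in I) (green C e a b x y * h y)%:E)%E = J%:E.
  by rewrite /J /Rintegral fineK//; apply: integrable_fin_num => //; exact: green_integrable.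
have fz : f z = f (pt e a) - J.
  have [_ E] := fg x xab; rewrite -[J]E /z; lra.
have f_le y : a < y < b -> f (pt e y) <= f (pt e a).
  move=> /andP[ay yb]; have yab : a <= y <= b by rewrite !ltW.
  rewrite -subr_ge0; have [_ ->] := fg y yab.
  apply: Rintegral_ge0 => u /I_itv uab; rewrite mulr_ge0 ?green_ge0//.
  by have /andP[] := h01 u.
exists (f (pt e a)) => // N N0.
pose sig w := fine (exit_upto X e a b N w).
pose F w := f (X (sig w) w) - f z.
have EF : (\int[m]_(p in before (exit_upto X e a b N)) (h (coord p))%:E =
    \int[law P z]_w (F w)%:E)%E.
  rewrite -(dynkin_formula hX a0 bl z N0 cf f0 fM gen).
  apply: eq_integral => -[t w]; rewrite inE => -[/= t0]; rewrite lt_min => /andP[tT _].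
  have [h1 h2 _] := before_exit_coord hX a0 bl t0 tT.
  by have [-> _] := fg (process_coord X e (t, w)) (ltac:(by rewrite !ltW)).
have mupto := measurable_exit_upto hX a0 bl N.
have mF : measurable_fun setT F.
  apply: measurable_funB => //.
  have := measurableT_comp (measurable_path_function hX cf (lexx 0))
    (measurable_fun_pair (measurableT_comp (fine_measurable measurableT) mupto) (@measurable_id _ Om setT)).
  apply: eq_measurable_fun => w _ /=; rewrite addr0 max_r//.
  by have /andP[] := exit_upto_bounds X e a b N0 w.
have lawT_lty : (law P z setT < +oo)%E by rewrite law_setT ltry.
have iF : (law P z).-integrable setT (EFin \o F).
  apply: (@bounded_integrable _ _ _ (law P z) setT _ (Mf + Mf)) => // w _.
  by rewrite (le_trans (ler_normB _ _))// lerD.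
(* The position at the exit is only known for paths started at [z]; the others form a null set. *)
have EZ : (\int[law P z]_w (F w)%:E = \int[law P z]_(w in Z0) (F w)%:E)%E.
  rewrite (negligible_integral (measurableC mZ) measurableT iF lawZ0C).
  by rewrite setDE setCK setTI.
have iFZ : (law P z).-integrable Z0 (EFin \o F) by exact: integrableS iF.
have iJZ : (law P z).-integrable Z0 (cst J%:E).
  apply: (@bounded_integrable _ _ _ (law P z) Z0 (cst J) `|J|) => //.
  by rewrite -[X in (X < _)%E]/(law P z Z0) lawZ0 ltry.
have JZ : (\int[law P z]_(w in Z0) J%:E = J%:E)%E.
  by rewrite integral_cst// -[X in (_ * X)%E]/(law P z Z0) lawZ0 mule1.
(* If [T w <= N], the common value of [f] at both ends makes [F w] equal to [J]. Otherwise [f] is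
   between [0] and [f (pt e a)] at the time [N], by [f_le], so [F w] is between [J - f (pt e a)] and
   [J]. *)
have FJ w : Z0 w -> F w <= J /\ J <= F w + f (pt e a) * \1_(late N) w.
  move=> Zw; rewrite /F fz indicE.
  have [NT|TN] := ltP N%:E (T w).
    rewrite mem_set// mulr1.
    have -> : sig w = N by rewrite /sig /exit_upto min_r// ltW.
    have [h1 h2 ->] := before_exit_coord hX a0 bl N0 NT.
    have h3 := f_le (process_coord X e (N, w)) (ltac:(by rewrite h1)).
    have h4 := f0 (pt e (process_coord X e (N, w))).
    split; first by rewrite lerBlDr [J + _]addrC subrK.
    by rewrite opprB addrA subrK lerDr.
  rewrite memNset; last by rewrite /late/= ltNge TN.
  have sT : exit_upto X e a b N w = T w by rewrite /exit_upto min_l.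
  have -> : f (X (sig w) w) = f (pt e a).
    have := exit_endpoint Zw (t := sig w); rewrite -sT exit_upto_fin//.
    by move=> /(_ erefl)[->|->].
  by rewrite mulr0 addr0 opprB addrCA subrr addr0.
rewrite EF EZ JE; split.
  by rewrite -JZ; apply: le_integral => // w; rewrite inE => /FJ[h1 _]; rewrite lee_fin.
rewrite -JZ.
have iind : (law P z).-integrable Z0 (EFin \o (fun w => f (pt e a) * \1_(late N) w)).
  apply: (@bounded_integrable _ _ _ (law P z) Z0 _ (f (pt e a))) => //.
  - by rewrite -[X in (X < _)%E]/(law P z Z0) lawZ0 ltry.
  - by apply: measurable_funTS; apply: measurable_funM => //; exact: measurable_indic.
  - move=> w _; rewrite normrM ger0_norm// ler_piMr// indicE.
    by case: (_ \in _); rewrite ?normr1 ?normr0.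
apply: (@le_trans _ _ (\int[law P z]_(w in Z0) (F w + f (pt e a) * \1_(late N) w)%:E)%E).
  apply: le_integral => //.
    by under eq_fun do rewrite EFinD; exact: integrableD.
  by move=> w; rewrite inE => /FJ[_ h1]; rewrite lee_fin.
under eq_integral do rewrite EFinD.
have indE : (\int[law P z]_(w in Z0) (f (pt e a) * \1_(late N) w)%:E =
    (f (pt e a))%:E * law P z (late N `&` Z0))%E.
  under eq_integral do rewrite EFinM.
  rewrite ge0_integralZl_EFin//; last first.
    by apply/measurable_EFinP; apply: measurable_funTS; exact: measurable_indic.
  by rewrite integral_indic.
rewrite integralD_EFin//; apply: leeD => //.
apply: (@le_trans _ _ ((f (pt e a))%:E * law P z (late N `&` Z0))%E); first by rewrite -indE.
apply: lee_wpmul2l; first by rewrite lee_fin.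
by apply: le_measure; rewrite ?inE//; exact: measurableI.
Qed.

(** * Tents increasing to indicators of intervals, and removal of the truncation *)

Let tent (l r : R) (n : nat) (y : R) : R :=
  Num.min 1 (n%:R * Num.max 0 (Num.min (y - l) (r - y))).

Let tent_continuous l r n : continuous (tent l r n).
Proof.
move=> u; apply: (@continuous_min R R (cst 1) _ u (cvg_cst _)).
apply: cvgM; first exact: cvg_cst.
apply: (@continuous_max R R (cst 0) _ u (cvg_cst _)).
apply: (@continuous_min R R (fun y => y - l) (fun y => r - y) u).
  by apply: cvgB; [exact: cvg_id|exact: cvg_cst].
by apply: cvgB; [exact: cvg_cst|exact: cvg_id].
Qed.

Let tent01 l r n y : 0 <= tent l r n y <= 1.
Proof.
by rewrite /tent le_min ler01 mulr_ge0//= ?ge_min ?lexx// le_max lexx.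
Qed.

Let tent0 l r n y : ~~ (l < y < r) -> tent l r n y = 0.
Proof.
rewrite negb_and -!leNgt /tent => H.
have hmin : Num.min (y - l) (r - y) <= 0 by rewrite ge_min !subr_le0.
by rewrite max_l// mulr0 min_r.
Qed.

Let tent_nd l r y : {homo (fun n => tent l r n y) : k n / (k <= n)%N >-> k <= n}.
Proof.
move=> k n kn; rewrite /tent le_min !ge_min lexx/=; apply/orP; right.
by rewrite ler_wpM2r ?ler_nat// le_max lexx.
Qed.

Let tent_cvg l r y : tent l r n y @[n --> \oo] --> (\1_(`]l, r[%classic) y : R).
Proof.
have -> : \1_(`]l, r[%classic) y = (l < y < r)%R%:R :> R.
  by rewrite indicE; congr (nat_of_bool _)%:R; apply/idP/idP; rewrite inE/= in_itv.
case: (boolP (l < y < r)) => [/andP[ly yr]|nlr]; last first.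
  by under eq_fun do rewrite tent0//; exact: cvg_cst.
apply: cvg_near_cst.
pose u := Num.min (y - l) (r - y).
have u0 : 0 < u by rewrite lt_min !subr_gt0 ly.
have [n0 _ nP] := near_infty_natSinv_lt (PosNum u0).
exists n0.+1 => // -[//|n] /= n0n; rewrite /tent -/u max_r ?ltW// min_l//.
by have := nP n n0n; rewrite /= invf_plt ?posrE// => /ltW; rewrite -ler_pdivrMr// mul1r.
Qed.

Let tent_itv l r n : a <= l -> r <= b ->
  forall y, y \notin `[a, b] -> tent l r n y = 0.
Proof.
move=> al rb y yn; apply: tent0; apply: contra yn => /andP[ly yr].
by rewrite in_itv/= (le_trans al (ltW ly)) (le_trans (ltW yr) rb).
Qed.

Let Gr : R -> R := green C e a b x.
Let D n := before (exit_upto X e a b n%:R).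
Let Dall := before T.

Let mD n : measurable (D n).
Proof. exact: (measurable_before (measurable_exit_upto hX a0 bl n%:R)). Qed.

Let mDall : measurable Dall. Proof. exact: measurable_before. Qed.

Let bigcup_D : \bigcup_n D n = Dall.
Proof.
apply/seteqP; split=> [[t w] [n _ [/= t0]]|[t w] [/= t0 tT]].
  by rewrite lt_min => /andP[tT _].
exists (Num.truncn t).+1 => //; split => //=.
by rewrite lt_min tT/= lte_fin truncnS_gt.
Qed.

Let D_nd : nondecreasing_seq D.
Proof.
move=> k n kn; apply/subsetPset => -[t w] [/= t0]; rewrite lt_min => /andP[tT tk].
split => //=; rewrite lt_min tT/=; apply: lt_le_trans tk _.
by rewrite lee_fin ler_nat.
Qed.

Let D_sub n : D n `<=` Dall. Proof. by rewrite -bigcup_D; exact: bigcup_sup. Qed.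

Let coord_I p : Dall p -> I (coord p).
Proof.
case: p => t w [/= t0 tT]; have [h1 h2 _] := before_exit_coord hX a0 bl t0 tT.
by rewrite /I/= in_itv/= h1.
Qed.

Let mcoord : measurable_fun setT coord.
Proof. exact: (measurable_process_coord hX). Qed.

Let gI := (\int[sp]_(y in I) (Gr y)%:E)%E.

Let Gr_ge0 y : I y -> (0 <= (Gr y)%:E)%E.
Proof. by move=> /I_itv yab; rewrite lee_fin green_ge0. Qed.

Let mGr : measurable_fun I (fun y => (Gr y)%:E).
Proof. exact/measurable_EFinP. Qed.

Let gI_ge0 : (0 <= gI)%E. Proof. exact: integral_ge0. Qed.

Let gI_fin : gI \is a fin_num.
Proof.
apply: integrable_fin_num => //.
apply: (bounded_integrable mI sp_lty measurable_green (K := s b - s a)) => y /I_itv yab.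
by rewrite ger0_norm ?green_ge0 ?green_le.
Qed.

Let tent_measurable (l r : R) n : measurable_fun setT (tent l r n : measurableTypeR R -> R).
Proof. by apply: continuous_measurable_fun; exact: tent_continuous. Qed.

Let cvg_occupation_tent l r (B : set (measurableTypeR R * Om)) : measurable B ->
  (\int[m]_(p in B) (tent l r n (coord p))%:E)%E @[n --> \oo] -->
  (\int[m]_(p in B) (\1_(`]l, r[%classic) (coord p))%:E)%E.
Proof.
move=> mB; apply: nondecreasing_cvg_integral => //.
- move=> n; apply/measurable_EFinP; apply: measurable_funTS.
  exact: (measurableT_comp (tent_measurable l r n) mcoord).
- by move=> n p _; rewrite lee_fin; have /andP[] := tent01 l r n (coord p).
- by move=> p _ k n kn; rewrite lee_fin; exact: tent_nd.
- by move=> p _; apply: cvgn_EFin; exact: tent_cvg.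
Qed.

Let cvg_green_tent l r :
  (\int[sp]_(y in I) (Gr y * tent l r n y)%:E)%E @[n --> \oo] -->
  (\int[sp]_(y in I) (Gr y * \1_(`]l, r[%classic) y)%:E)%E.
Proof.
apply: nondecreasing_cvg_integral => //.
- move=> n; apply/measurable_EFinP; apply: measurable_funM => //.
  exact: measurable_funTS.
- move=> n y /I_itv yab; rewrite lee_fin mulr_ge0 ?green_ge0//.
  by have /andP[] := tent01 l r n y.
- move=> y /I_itv yab k n kn; rewrite lee_fin ler_wpM2l ?green_ge0//.
  exact: tent_nd.
- by move=> y _; apply: cvgn_EFin; apply: cvgM; [exact: cvg_cst|exact: tent_cvg].
Qed.

(** The measure of [D n] is the expectation of the exit time truncated at [n]. Tents increasing to
    the indicator of []a, b[] in the first half of [occupation_bounds] give a bound that is uniform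
    in [n]. *)
Let measure_D_le n : (m (D n) <= gI)%E.
Proof.
have -> : m (D n) = (\int[m]_(p in D n) (\1_(`]a, b[%classic) (coord p))%:E)%E.
  rewrite (eq_integral (cst 1%E)) ?integral_cst ?mul1e//.
  move=> p; rewrite inE => /D_sub/coord_I pI.
  by rewrite indicE mem_set.
have cv := @cvg_occupation_tent a b (D n) (mD n).
rewrite -(cvg_lim _ cv)//; apply: lime_le; first by apply/cvg_ex; eexists; exact: cv.
apply: nearW => k.
have [M _ /(_ n%:R (ler0n _ _))[+ _]] := occupation_bounds (@tent_continuous a b k)
  (tent01 a b k) (tent_itv k (lexx a) (lexx b)).
move=> /le_trans; apply; apply: ge0_le_integral => //.
- move=> y /I_itv yab; rewrite lee_fin mulr_ge0 ?green_ge0//.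
  by have /andP[] := tent01 a b k y.
- by apply/measurable_EFinP; apply: measurable_funM => //; exact: measurable_funTS.
- move=> y /I_itv yab; rewrite lee_fin ler_piMr ?green_ge0//.
  by have /andP[] := tent01 a b k y.
Qed.

(** Markov's inequality: on [late n%:R] the truncated exit time equals [n]. *)
Let late_le n : (n%:R%:E * law P z (late n%:R) <= gI)%E.
Proof.
apply: le_trans (measure_D_le n).
have up0 w : (0 <= exit_upto X e a b n%:R w)%E.
  by rewrite le_min exit_of_ge0 lee_fin ler0n.
have mup := measurable_exit_upto hX a0 bl n%:R.
rewrite /m /D measure_before//.
have lE : (\int[law P z]_w (\1_(late n%:R) w)%:E = law P z (late n%:R))%E.
  by rewrite integral_indic// setIT.
rewrite -lE.
rewrite -ge0_integralZl_EFin//; last exact/measurable_EFinP/measurable_indic.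
apply: ge0_le_integral => //.
  by apply: measurable_funeM; exact/measurable_EFinP/measurable_indic.
move=> w _; rewrite indicE; case: (boolP (w \in late n%:R)) => [|_]; last by rewrite mule0.
by rewrite inE /late/= mule1 /exit_upto => nT; rewrite min_r// ltW.
Qed.

(** Both inequalities of [occupation_bounds] pass to the limit: [D n] increases to [Dall], and by
    [late_le] the error is at most [M * fine gI / n]. *)
Lemma occupation_tent (h : R -> R) : continuous h ->
  (forall y, 0 <= h y <= 1) -> (forall y, y \notin `[a, b] -> h y = 0) ->
  (\int[m]_(p in Dall) (h (coord p))%:E = \int[sp]_(y in I) (Gr y * h y)%:E)%E.
Proof.
move=> ch h01 h0; have [M M0 bounds] := occupation_bounds ch h01 h0.
have mhc : measurable_fun setT (fun p => (h (coord p))%:E).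
  apply/measurable_EFinP; apply: (measurableT_comp _ mcoord).
  exact: continuous_measurable_fun.
have hc0 p : (0 <= (h (coord p))%:E)%E by rewrite lee_fin; have /andP[] := h01 (coord p).
have cv : (\int[m]_(p in D n) (h (coord p))%:E)%E @[n --> \oo] -->
    (\int[m]_(p in Dall) (h (coord p))%:E)%E.
  rewrite -bigcup_D; apply: ge0_nondecreasing_set_cvg_integral => //.
  by move=> n; exact: measurable_funTS.
apply/eqP; rewrite eq_le; apply/andP; split.
  rewrite -(cvg_lim _ cv)//; apply: lime_le; first by apply/cvg_ex; eexists; exact: cv.
  by apply: nearW => n; have [] := bounds n%:R (ler0n _ _).
apply/lee_addgt0Pr => eps eps0.
have [n nE] : exists n : nat, M * fine gI / n.+1%:R <= eps.
  have c0 : 0 <= M * fine gI by rewrite mulr_ge0// fine_ge0// gI_ge0.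
  exists (Num.truncn (M * fine gI / eps)).
  rewrite ler_pdivrMr// [eps * _]mulrC -ler_pdivrMr//; apply: ltW; exact: truncnS_gt.
have [_ /le_trans] := bounds n.+1%:R (ler0n _ _); apply.
apply: leeD.
  apply: (@ge0_subset_integral _ _ _ m (D n.+1) Dall) => //.
  exact: measurable_funTS.
apply: (@le_trans _ _ ((M * fine gI / n.+1%:R)%:E)); last by rewrite lee_fin.
have Pfin : law P z (late n.+1%:R) \is a fin_num by exact: fin_num_measure.
have h1 : n.+1%:R * fine (law P z (late n.+1%:R)) <= fine gI.
  by rewrite -lee_fin EFinM !fineK//; exact: late_le.
rewrite -(fineK Pfin) -EFinM lee_fin -mulrA ler_wpM2l// ler_pdivlMr//.
by rewrite [_ * n.+1%:R]mulrC.
Qed.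

(** * Equality of the occupation measure [occ] and of the measure [grn] with density [green] *)

Let occ (A : set (measurableTypeR R)) := m (coord @^-1` A `&` Dall).
Let grn (A : set (measurableTypeR R)) := (\int[sp]_(y in I `&` A) (Gr y)%:E)%E.

Let mpre A : measurable A -> measurable (coord @^-1` A).
Proof. by move=> mA; rewrite -[X in measurable X]setTI; exact: mcoord. Qed.

Let occ_indic A : measurable A ->
  occ A = (\int[m]_(p in Dall) (\1_A (coord p))%:E)%E.
Proof. by move=> mA; exact/esym/(integral_indic m mDall (mpre mA)). Qed.

Let grn_indic A : grn A = (\int[sp]_(y in I) (Gr y * \1_A y)%:E)%E.
Proof.
rewrite /grn integral_mkcondr; apply: eq_integral => y _.
by rewrite patchE indicE; case: ifP => _; rewrite ?mulr1 ?mulr0.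
Qed.

Let occ_itv l r : occ `]l, r[%classic = grn `]l, r[%classic.
Proof.
(* Tents over the interval cut down to [[a, b]] vanish off [[a, b]], as [occupation_tent] requires;
   on [I] the indicators agree. *)
pose l' := Num.max a l; pose r' := Num.min b r.
have E y : I y -> \1_(`]l, r[%classic) y = \1_(`]l', r'[%classic) y :> R.
  rewrite /I/= in_itv/= => /andP[ay yb]; rewrite !indicE; congr (nat_of_bool _)%:R.
  apply/idP/idP; rewrite !inE/= !in_itv/= gt_max lt_min ay yb//=.
have al' : a <= l' by rewrite le_max lexx.
have rb' : r' <= b by rewrite ge_min lexx.
rewrite occ_indic// grn_indic.
transitivity (\int[m]_(p in Dall) (\1_(`]l', r'[%classic) (coord p))%:E)%E.
  by apply: eq_integral => p; rewrite inE => /coord_I/E ->.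
transitivity (\int[sp]_(y in I) (Gr y * \1_(`]l', r'[%classic) y)%:E)%E; last first.
  by apply: eq_integral => y; rewrite inE => /E ->.
have c1 := @cvg_occupation_tent l' r' Dall mDall.
have c2 := @cvg_green_tent l' r'.
rewrite -(cvg_lim _ c1)// -(cvg_lim _ c2)//; congr (limn _); apply/funext => n.
exact: occupation_tent (@tent_continuous l' r' n) (tent01 l' r' n) (tent_itv n al' rb').
Qed.

Let occT : occ setT = grn setT.
Proof.
have := occ_itv a b; rewrite /grn setIid setIT; apply: etrans.
rewrite /occ preimage_setT setTI; congr (m _).
by apply/seteqP; split=> [p Dp|p []//]; split => //; exact: coord_I.
Qed.

(** The pi-lambda theorem, from the open intervals, which are stable under intersection. For
    complements, the masses of the whole line agree and [grn A] is finite, so it can be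
    cancelled. *)
Lemma occupation_set A : measurable A -> occ A = grn A.
Proof.
have grnU B E : measurable B -> measurable E -> [disjoint B & E] ->
    grn (B `|` E) = (grn B + grn E)%E.
  move=> mB mE /disj_setPS BE; rewrite /grn setIUr ge0_integral_setU//.
  - exact: measurableI.
  - exact: measurableI.
  - by rewrite -setIUr; exact: measurable_funS mGr.
  - by move=> y; rewrite -setIUr => -[/Gr_ge0].
  - by apply/disj_setPS => y [[_ By] [_ Ey]]; exact: BE.
move=> mA; have := mA; rewrite RGenOpens.measurableE; move: A {mA}.
apply: (@dynkin_induction _ (measurableTypeR R) _ (fun A => occ A = grn A)
  (RGenOpens.measurableE R)) => //.
- move=> _ _ [l [r ->]] [l' [r' ->]]; exists (Num.max l l'), (Num.min r r').
  apply/seteqP; split => y /=; rewrite !in_itv/= gt_max lt_min.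
    by move=> [/andP[-> ->] /andP[-> ->]].
  by move=> /andP[/andP[-> ->] /andP[-> ->]].
- by move=> _ [l [r ->]]; exact: occ_itv.
- move=> A mA AE.
  have dA : [disjoint A & ~` A] by apply/disj_setPS; rewrite setICr.
  have gT : grn setT = (grn A + grn (~` A))%E.
    by rewrite -grnU ?setUv//; exact: measurableC.
  have oT : occ setT = (occ A + occ (~` A))%E.
    rewrite /occ -measureU; [|exact: measurableI (mpre mA) mDall|
      exact: measurableI (mpre (measurableC mA)) mDall|].
      by rewrite -setIUl -preimage_setU setUv.
    by rewrite setIACA -preimage_setI setICr preimage_set0 set0I.
  have gA : grn A \is a fin_num.
    rewrite ge0_fin_numE; last by apply: integral_ge0 => y [/Gr_ge0].
    apply: (@le_lt_trans _ _ gI); last by rewrite -ge0_fin_numE// gI_ge0.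
    by apply: ge0_subset_integral => //; exact: measurableI.
  move: oT; rewrite occT gT AE ; rewrite ![(grn A + _)%E]addeC => gE.
  by rewrite -(addeK (occ (~` A)) gA) -gE addeK.
- move=> F mF tF FE; rewrite /occ /grn preimage_bigcup setI_bigcupl setI_bigcupr.
  have mG n : measurable (coord @^-1` F n `&` Dall) by exact: measurableI (mpre (mF n)) mDall.
  have tG : trivIset setT (fun n => coord @^-1` F n `&` Dall).
    apply/trivIsetP => i j _ _ ij.
    move/trivIsetP : tF => /(_ i j Logic.I Logic.I ij) Fij.
    by rewrite setIACA -preimage_setI Fij preimage_set0 set0I.
  have oU : m (\bigcup_n (coord @^-1` F n `&` Dall)) =
      (\sum_(n <oo) m (coord @^-1` F n `&` Dall))%E.
    by apply: measure_semi_bigcup => //; exact: bigcupT_measurable.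
  rewrite oU.
  rewrite ge0_integral_bigcup//; last 4 first.
  - by move=> n; exact: measurableI.
  - by apply: measurable_funS mGr => // y [n _ []].
  - by move=> y [n _ [/Gr_ge0]].
  - apply/trivIsetP => i j _ _ ij.
    move/trivIsetP : tF => /(_ i j Logic.I Logic.I ij) Fij.
    by rewrite setIACA Fij setI0.
  by apply: eq_eseriesr => n _; exact: FE.
Qed.

Lemma green_occupation (V : measurableTypeR R -> \bar R) :
  measurable_fun setT V -> (forall y, (0 <= V y)%E) ->
  (\int[m]_(p in Dall) V (coord p) = \int[sp]_(y in I) ((Gr y)%:E * V y))%E.
Proof.
have mc V' : measurable_fun setT (V' : measurableTypeR R -> \bar R) ->
    measurable_fun Dall (fun p => V' (coord p)).
  by move=> mV; apply: measurable_funTS; exact: (measurableT_comp mV mcoord).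
have mg V' : measurable_fun setT (V' : measurableTypeR R -> \bar R) ->
    measurable_fun I (fun y => (Gr y)%:E * V' y)%E.
  by move=> mV; apply: emeasurable_funM => //; exact: measurable_funTS.
move: V; apply: ge0_measurable_ind.
- move=> A mA; rewrite -occ_indic// (occupation_set mA) grn_indic.
  by apply: eq_integral => y _; rewrite EFinM.
- move=> c f c0 mf f0 IH.
  rewrite ge0_integralZl_EFin//; last exact: mc.
  rewrite IH -ge0_integralZl_EFin//; last 2 first.
  - by move=> y /Gr_ge0 ?; rewrite mule_ge0.
  - exact: mg.
  by apply: eq_integral => y _; rewrite muleCA.
- move=> f g mf mg' f0 g0 If Ig.
  rewrite ge0_integralD//; [|exact: mc|exact: mc].
  rewrite If Ig -ge0_integralD//; last 4 first.
  - by move=> y /Gr_ge0 ?; rewrite mule_ge0.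
  - exact: mg.
  - by move=> y /Gr_ge0 ?; rewrite mule_ge0.
  - exact: mg.
  by apply: eq_integral => y _; rewrite ge0_muleDr.
- move=> F f mF mf F0 ndF Ff IH.
  have c1 : (\int[m]_(p in Dall) F n (coord p))%E @[n --> \oo] -->
      (\int[m]_(p in Dall) f (coord p))%E.
    apply: (@nondecreasing_cvg_integral _ _ _ m Dall (fun n p => F n (coord p))) => //.
    by move=> n; exact: mc.
  have c2 : (\int[sp]_(y in I) ((Gr y)%:E * F n y))%E @[n --> \oo] -->
      (\int[sp]_(y in I) ((Gr y)%:E * f y))%E.
    apply: (@nondecreasing_cvg_integral _ _ _ sp I (fun n y => (Gr y)%:E * F n y)%E) => //.
    - by move=> n; exact: mg.
    - by move=> n y /Gr_ge0 ?; rewrite mule_ge0.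
    - by move=> y /Gr_ge0 ? k n kn; rewrite lee_wpmul2l// ndF.
    - by move=> y _; apply: cvgeZl.
  rewrite -(cvg_lim _ c1)// -(cvg_lim _ c2)//.
  by congr (limn _); apply/funext => n; exact: IH.
Qed.

End green_occupation.

Theorem proposition3p2 (R : realType) (G : star_graph R)
    (C : diffusion_coefs G)
    (d : measure_display) (Om : measurableType d)
    (P : R.-pker (borel_star G) ~> Om) (X : R -> Om -> star G)
    (hX : general_diffusion P X C)
    (D : subdivision G) (e : edge G) (a b : R)
    (ha : 0 < a) (hab : a < b) (hb : (b%:E < len e)%E)
    (hU : is_cell D (seg e a b%:E))
    (j : set (star G)) (hj : edges D j)
    (k : nat) (hk : (1 <= k)%N) (x : R) (hx : a < x < b) :
  let v := exit_moment P X (seg e a b%:E) j in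
  (v k (pt e x) =
   k%:R%:E *
     \int[speed C e]_(y in `]a, b[)
       ((green C e a b x y)%:E * v k.-1 (pt e y)))%E.
Proof.
move=> v; case: k hk => // k _ /=; have /andP[ax xb] := hx.
rewrite /v (exit_moment_occupation hX ha hb j k (pt e x)); congr (_ * _)%E.
rewrite (green_occupation hX ha hb ax xb).
(* The integral is over []a, b[], where the restricted moment is the moment itself. *)
- apply: eq_integral => y; rewrite inE/= => yab.
  by rewrite patchE mem_set.
- exact: (measurable_exit_moment_pt hX ha hb j k).
- by move=> y; rewrite patchE; case: ifP => // _; exact: exit_moment_ge0.
Qed.
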